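(* Let $a,A,b,B\in\mathbb{C}\setminus\{0\}$. If $n=\pm(2m+1)$, $m\to\infty$, then $$\beta_n^-(z)=\sigma_0^-(n,0)\left[1+O\left(\frac{\log m}{m}\right)\right]\quad\text{if } z=O(1/m)$$ and $$\beta_n^-(z_n^\pm)=\sigma_0^-(n,0)\left[1+O\left(\frac{\log^2m}{m^2}\right)\right],$$ with $$\sigma_0^-(n,0)=\begin{cases}\dfrac{a^{m+1}b^{m}}{4^{2m}(m!)^2}&\text{for } n=2m+1,\\[2mm]\dfrac{A^{m+1}B^{m}}{4^{2m}(m!)^2}&\text{for } n=-2m-1.\end{cases}$$
   Context: Let $P(x)=ae^{-2ix}+Ae^{2ix}$, $Q(x)=be^{-2ix}+Be^{2ix}$, with Fourier coefficients $p(-2)=a$, $p(2)=A$, $q(-2)=b$, $q(2)=B$, and $p(k)=q(k)=0$ for $k\ne\pm2$. Eigenvalues: consider $Ly=i\begin{pmatrix}1&0\\0&-1\end{pmatrix}y'+\begin{pmatrix}0&P\\Q&0\end{pmatrix}y$ on $[0,\pi]$ with periodic ($y(\pi)=y(0)$) or antiperiodic ($y(\pi)=-y(0)$) boundary conditions. It is known that for $|n|$ large enough the disc $\{|\lambda-n|<1/2\}$ contains exactly two (counted with algebraic multiplicity) periodic (if $n$ is even) or antiperiodic (if $n$ is odd) eigenvalues $\lambda_n^-,\lambda_n^+$, ordered so that $\operatorname{Re}\lambda_n^-<\operatorname{Re}\lambda_n^+$, or the real parts are equal and $\operatorname{Im}\lambda_n^-\le\operatorname{Im}\lambda_n^+$.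 Put $z_n^\pm=\lambda_n^\pm-n$. Functions: for $|n|$ large and $|z|\le1/2$ put (all $j_k\in n+2\mathbb{Z}$, $j_k\neq n$) $$\alpha_n(z)=\sum_{\nu\ge1}\sum_{j_1,\dots,j_{2\nu-1}}\frac{p(-n-j_1)q(j_1+j_2)\cdots p(-j_{2\nu-2}-j_{2\nu-1})q(j_{2\nu-1}+n)}{(n-j_1+z)\cdots(n-j_{2\nu-1}+z)},$$ $$\beta_n^+(z)=q(2n)+\sum_{\nu\ge1}\sum_{j_1,\dots,j_{2\nu}}\frac{q(n+j_1)p(-j_1-j_2)\cdots p(-j_{2\nu-1}-j_{2\nu})q(j_{2\nu}+n)}{(n-j_1+z)\cdots(n-j_{2\nu}+z)},$$ $$\beta_n^-(z)=p(-2n)+\sum_{\nu\ge1}\sum_{j_1,\dots,j_{2\nu}}\frac{p(-n-j_1)q(j_1+j_2)\cdots q(j_{2\nu-1}+j_{2\nu})p(-j_{2\nu}-n)}{(n-j_1+z)\cdots(n-j_{2\nu}+z)}.$$ It is known that for $|n|$ large, $z_n^-,z_n^+$ are exactly the roots (with multiplicity) in $|z|\le1/2$ of $(z-\alpha_n(z))^2=\beta_n^-(z)\beta_n^+(z)$. Walks: an admissible walk from $n$ to $-n$ is a sequence $y=(y_t)_{t=1}^{2\nu+1}$ with $y_t=\pm2$, $\sum y_t=-2n$, whose vertices $j_k=n+\sum_{t\le k}y_t$ ($1\le k\le2\nu$) satisfy $j_1,j_3,\dots,j_{2\nu-1}\ne-n$ and $j_2,j_4,\dots,j_{2\nu}\ne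 n$. Put $$h^-(y,z)=\frac{p(y_1)q(y_2)p(y_3)\cdots q(y_{2\nu})p(y_{2\nu+1})}{(n+j_1+z)(n-j_2+z)\cdots(n+j_{2\nu-1}+z)(n-j_{2\nu}+z)}.$$ Let $Y_n(r)$ be the set of admissible walks from $n$ to $-n$ with exactly $r$ positive steps if $n>0$, or exactly $r$ negative steps if $n<0$, and $\sigma_r^-(n,z)=\sum_{y\in Y_n(r)}h^-(y,z)$; then $\beta_n^-(z)=\sum_{r\ge0}\sigma_r^-(n,z)$. The statement ''if $z=O(1/m)$'' means: for every constant $K>0$ the estimate holds uniformly for $|z|\le K/m$ and $m$ large, with $O$-constant depending only on $K,a,A,b,B$. Other $O$-constants depend only on $a,A,b,B$. *)

(* Defs.v *)
From HB Require Import structures.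
From mathcomp Require Import all_boot all_order all_algebra.
From mathcomp Require Import complex.
From mathcomp Require Import all_classical all_reals all_analysis.

Set Implicit Arguments.
Unset Strict Implicit.
Unset Printing Implicit Defensive.

Import Order.TTheory GRing.Theory Num.Theory.
Import numFieldNormedType.Exports.

Local Open Scope classical_set_scope.
Local Open Scope ring_scope.
Local Open Scope complex_scope.

Section Potentials.
Context {R : realType}.
Local Notation C := R[i].

(* Fourier coefficients of c e^{-2ix} + d e^{2ix}; used with (a, A) for P and
   with (b, B) for Q. *)
Definition coef2 (c d : C) (k : int) : C :=
  if k == -2 then c else if k == 2 then d else 0.

Definition expi (x : R) : C := cos x +i* sin x.

Definition pot (c d : C) (x : R) : C :=
  c * expi (- 2 * x) + d * expi (2 * x).

End Potentials.

Section Spectrum.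
Context {R : realType}.
Local Notation C := R[i].
(* ^o makes pairs into a C-module. *)
Local Notation C2 := (C^o * C^o)%type.

Definition cderivable (f : R -> C) (x : R) : Prop :=
  derivable (fun t => complex.Re (f t)) x 1 /\ derivable (fun t => complex.Im (f t)) x 1.

Definition cderiv (f : R -> C) (x : R) : C :=
  derive1 (fun t => complex.Re (f t)) x +i* derive1 (fun t => complex.Im (f t)) x.

Definition ccontinuous_on (D : set R) (f : R -> C) : Prop :=
  {within D, continuous (fun t => complex.Re (f t))} /\
  {within D, continuous (fun t => complex.Im (f t))}.

(* The domain of L: only the values of y on [0, pi] matter.  The boundary
   condition is periodic for n even and antiperiodic for n odd. *)
Definition dirac_dom (n : int) (y : R -> C2) : Prop :=
  [/\ ccontinuous_on `[0, pi]%classic (fun t => (y t).1),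
      ccontinuous_on `[0, pi]%classic (fun t => (y t).2),
      (forall x : R, 0 < x < pi ->
         cderivable (fun t => (y t).1) x /\ cderivable (fun t => (y t).2) x)
    & y pi = (-1) ^+ `|n|%N *: y 0].

Definition dirac_op (a A b B : C) (y : R -> C2) (x : R) : C2 :=
  ('i%C * cderiv (fun t => (y t).1) x + pot a A x * (y x).2,
   - 'i%C * cderiv (fun t => (y t).2) x + pot b B x * (y x).1).

(* y (restricted to [0, pi]) lies in the kernel of (L - lam)^k.  The image w
   of y is prescribed on the open interval only; its values at the endpoints
   are then forced by the continuity of w. *)
Fixpoint in_ker_pow (a A b B : C) (n : int) (lam : C) (k : nat)
    (y : R -> C2) : Prop :=
  if k is k'.+1 then
    dirac_dom n y /\
    exists w : R -> C2,
      (forall x : R, 0 < x < pi -> w x = dirac_op a A b B y x - lam *: y x) /\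
      in_ker_pow a A b B n lam k' w
  else forall x : R, 0 <= x <= pi -> y x = 0.

Definition root_function (a A b B : C) (n : int) (lam : C) (y : R -> C2) :
    Prop :=
  exists k, in_ker_pow a A b B n lam k y.

(* The root space of lam, as a space of functions on [0, pi], has dimension d;
   d = 0 means that lam is not an eigenvalue. *)
Definition alg_mult (a A b B : C) (n : int) (lam : C) (d : nat) : Prop :=
  exists v : 'I_d -> R -> C2,
    [/\ forall i, root_function a A b B n lam (v i),
        forall c : 'I_d -> C,
          (forall x : R, 0 <= x <= pi -> \sum_(i < d) c i *: v i x = 0) ->
          forall i, c i = 0
      & forall y, root_function a A b B n lam y ->
          exists c : 'I_d -> C,
            forall x : R, 0 <= x <= pi -> y x = \sum_(i < d) c i *: v i x].

(* (l1, l2) = (lambda_n^-, lambda_n^+): the eigenvalues in the disc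
   |lam - n| < 1/2, repeated according to algebraic multiplicity, are exactly
   l1 and l2, listed in lexicographic order. *)
Definition eigen_pair (a A b B : C) (n : int) (l1 l2 : C) : Prop :=
  [/\ `|l1 - n%:~R| < 2^-1,
      `|l2 - n%:~R| < 2^-1,
      complex.Re l1 < complex.Re l2 \/ complex.Re l1 = complex.Re l2 /\ complex.Im l1 <= complex.Im l2
    & forall lam : C, `|lam - n%:~R| < 2^-1 ->
        alg_mult a A b B n lam ((lam == l1) + (lam == l2))%N].

End Spectrum.

Section Beta.
Context {R : realType}.
Local Notation C := R[i].

Definition indices (n : int) (N : nat) : set (N.-tuple int) :=
  [set j | forall i, tnth j i <> n /\ (tnth j i = n %[mod 2])%Z].

(* With the convention j_0 = j_{2nu+1} = n, the numerator is the product over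
   0 <= k <= 2nu of p(-j_k-j_{k+1}) (k even) and q(j_k+j_{k+1}) (k odd). *)
Definition beta_minus_term (a A b B : C) (n : int) (z : C) (nu : nat)
    (j : (2 * nu).-tuple int) : C :=
  let jj k := nth 0 (n :: rcons j n) k in
  (\prod_(0 <= k < (2 * nu).+1)
     (if odd k then coef2 b B (jj k + jj k.+1)
      else coef2 a A (- jj k - jj k.+1)))
  / \prod_(i < 2 * nu) ((n - tnth j i)%:~R + z).

(* For each nu only finitely many j give a nonzero term, as p and q vanish
   outside {-2, 2}; the sum over j is a finite-support sum. *)
Definition beta_minus (a A b B : C) (n : int) (z : C) : C :=
  coef2 a A (- (2 * n)) +
  limn (fun N => \sum_(1 <= nu < N)
         \sum_(j \in @indices n (2 * nu)) beta_minus_term a A b B n z j : C^o).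

End Beta.

Section Walks.
Context {R : realType}.
Local Notation C := R[i].

Definition vertex (n : int) (y : seq int) (k : nat) : int :=
  n + \sum_(t <- take k y) t.

(* Admissible walk from n to -n; the steps y_1, y_2, ... are y`_0, y`_1, ... *)
Definition admissible (n : int) (y : seq int) : Prop :=
  [/\ odd (size y),
      {in y, forall t : int, t = 2 \/ t = -2},
      \sum_(t <- y) t = - (2 * n)
    & forall k, (1 <= k < size y)%N ->
        vertex n y k <> (if odd k then - n else n)].

Definition walks (n : int) (r : nat) : set (seq int) :=
  [set y | admissible n y /\
     count (fun t : int => if 0 < n then 0 < t else t < 0) y = r].

Definition h_minus (a A b B : C) (n : int) (y : seq int) (z : C) : C :=
  (\prod_(0 <= k < size y)
     (if odd k then coef2 b B y`_k else coef2 a A y`_k))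
  / \prod_(1 <= k < size y)
      ((if odd k then n + vertex n y k else n - vertex n y k)%:~R + z).

Definition sigma_minus (a A b B : C) (r : nat) (n : int) (z : C) : C :=
  \sum_(y \in walks n r) h_minus a A b B n y z.

End Walks.

(* Main.v *)
Require Import Defs.
From HB Require Import structures.
From mathcomp Require Import all_boot all_order all_algebra.
From mathcomp Require Import complex.
From mathcomp Require Import all_classical all_reals all_analysis.
From mathcomp Require Import zify ring lra.

Set Implicit Arguments.
Unset Strict Implicit.
Unset Printing Implicit Defensive.

Import Order.TTheory GRing.Theory Num.Theory.
Import numFieldNormedType.Exports.

Local Open Scope ring_scope.
Local Open Scope complex_scope.

(** In a term of the series for beta_n^- put w_k = (-1)^k j_k.  The factors p
    and q force w to be a walk from n to -n with steps 2 and -2, and parity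
    turns the single condition j_k <> n into: w avoids both n and -n at all
    intermediate times.  For n = 2m + 1 the walk is therefore confined to the
    2m levels w = n - 2l, 1 <= l <= 2m, and its weights depend on the level
    only.  So beta_n^-(z) is a corner entry of the Neumann series of a
    tridiagonal matrix, that is
      beta_n^-(z) = a^(m+1) b^m / K(z),
    with K(z) the determinant of that matrix (beta_minus_continuant).  The
    series converges because consecutive diagonal entries have a product of
    order m at least (transfer_contraction).  The reflection j -> - j reduces
    n < 0 to n > 0 (beta_minusN).

    The product of the diagonal entries at z = 0 is 4^(2m) (m!)^2, which gives
    sigma_0^-(n, 0).  The quotient F of K(z) by it is the last term of a
    recurrence F_(k+1) = F_k + x_k F_k - g_k F_(k-1) with
    sum (|x_k| + |g_k|) = O(log m / m) when z = O(1/m), whence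
      F = 1 + sum (x_k - g_k) + O(log^2 m / m^2)   (perturbed_first_order).
    The sums are harmonic:
      sum (x_k - g_k) = H_m / 2 (z - (A b + a B) / (4m)) + O(log m / m^2)
    (continuant_first_order).  This already gives the first estimate, and it
    reduces the second one to z_n = (A b + a B) / (2n) + O(1/n^2).

    For the latter, an eigenvalue n + z with |z| <= 1/2 has an eigenfunction,
    whose Fourier coefficients solve a two-component recurrence
    (eigenfunction_system).  Only two of its
    coefficients are multiplied by the small number z.  They control all the
    others, two steps of the recurrence gaining a factor 1/n
    (resonant_control), and expanding the equation of the larger one by two
    steps determines z (resonant_expansion).  These coefficients do not all
    vanish because the exponentials of a given parity are complete on [0, pi]
    (fcoef_complete), which is proved with the kernels cos^(2N). *)

(** * The modulus of a complex number as a real number *)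

Notation cabs := Normc.normc.

Section Modulus.
Context {R : realType}.
Implicit Types z w : R[i].

Lemma normE z : `|z| = (cabs z)%:C.
Proof. by []. Qed.

Lemma cabs_ge0 z : 0 <= cabs z.
Proof. by rewrite -(@lecR R) -normE normr_ge0. Qed.

Lemma cabsM z w : cabs (z * w) = cabs z * cabs w.
Proof. exact: Normc.normcM. Qed.

Lemma cabsV z : cabs z^-1 = (cabs z)^-1.
Proof. exact: Normc.normcV. Qed.

Lemma cabsN z : cabs (- z) = cabs z.
Proof. exact: (@normcN R). Qed.

Lemma cabsD z w : cabs (z + w) <= cabs z + cabs w.
Proof. exact: (@le_normcD R). Qed.

Lemma cabsB z w : cabs (z - w) <= cabs z + cabs w.
Proof. by rewrite -(cabsN w); exact: cabsD. Qed.

Lemma cabs_sub_ge z w : cabs z - cabs w <= cabs (z + w).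
Proof. by have := cabsB (z + w) w; rewrite addrK lerBlDr. Qed.

Lemma cabs0 : cabs (0 : R[i]) = 0.
Proof. exact: Normc.normc0. Qed.

Lemma cabs1 : cabs (1 : R[i]) = 1.
Proof. exact: Normc.normc1. Qed.

Lemma cabs_eq0 z : (cabs z == 0) = (z == 0).
Proof.
by apply/eqP/eqP => [/Normc.eq0_normc //|->]; exact: cabs0.
Qed.

Lemma cabs_real (x : R) : cabs x%:C = `|x|.
Proof. by rewrite /= expr0n addr0 sqrtr_sqr. Qed.

Lemma cabs_int (k : int) : cabs (k%:~R : R[i]) = `|k|%:~R.
Proof.
have -> : (k%:~R : R[i]) = (k%:~R : R)%:C by rewrite rmorph_int.
by rewrite cabs_real -intr_norm.
Qed.

Lemma cabs_nat (k : nat) : cabs (k%:R : R[i]) = k%:R.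
Proof. by rewrite -[k%:R]/(k%:Z%:~R) cabs_int. Qed.

End Modulus.

(** * A perturbed constant recurrence *)

Section PerturbedRecurrence.
Context {R : realType}.
Variables (x g F : nat -> R[i]) (N : nat).
Let s (k : nat) : R := cabs (x k) + cabs (g k).
Let S : R := \sum_(i < N) s i.
Hypothesis F0 : F 0%N = 1.
Hypothesis FS : forall k, (k < N)%N -> F k.+1 = F k + x k * F k - g k * F k.-1.
Hypothesis S_le : S <= 2^-1.

Let s_ge0 k : 0 <= s k.
Proof. by rewrite addr_ge0 ?cabs_ge0. Qed.

Let partial_le k : (k <= N)%N -> \sum_(i < k) s i <= S.
Proof.
move=> kN; rewrite /S -!(big_mkord xpredT s) (@big_cat_nat _ _ _ k 0 N) /=; [|by []|by []].
by rewrite lerDl sumr_ge0.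
Qed.

(** Since S <= 1/2, the bound itself keeps |F| below 2, so that step k adds at
    most 2 s k. *)
Lemma perturbed_near1 k : (k <= N)%N ->
  cabs (F k - 1) <= 2 * \sum_(i < k) s i.
Proof.
elim/ltn_ind: k => -[_ _|k IH kN].
  by rewrite F0 subrr cabs0 big_ord0 mulr0.
have near j : (j <= k)%N -> cabs (F j) <= 2.
  move=> jk; have jN : (j <= N)%N by lia.
  have := cabsD (F j - 1) 1; rewrite subrK cabs1.
  move: (IH j jk jN) (partial_le jN) S_le.
  set T := \sum_(i < j) _; move: (T) (S) => T' S'; lra.
rewrite FS // big_ord_recr /=.
have -> : F k + x k * F k - g k * F k.-1 - 1 =
  (F k - 1) + (x k * F k - g k * F k.-1) by ring.
apply: le_trans (cabsD _ _) _.
have h1 := IH k (ltnSn k) (ltnW kN).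
have h2 := cabsB (x k * F k) (g k * F k.-1); rewrite !cabsM in h2.
have h3 : cabs (x k) * cabs (F k) <= cabs (x k) * 2.
  by rewrite ler_wpM2l ?cabs_ge0 ?near.
have h4 : cabs (g k) * cabs (F k.-1) <= cabs (g k) * 2.
  by rewrite ler_wpM2l ?cabs_ge0 ?near ?leq_pred.
rewrite /s in h1 *; lra.
Qed.

(** Replacing F by 1 in the increments costs 2 S s k at step k. *)
Lemma perturbed_first_order k : (k <= N)%N ->
  cabs (F k - 1 - \sum_(i < k) (x i - g i)) <= 2 * S * \sum_(i < k) s i.
Proof.
elim: k => [_|k IH kN]; first by rewrite F0 !big_ord0 !subrr cabs0 mulr0.
have near j : (j <= k)%N -> cabs (F j - 1) <= 2 * S.
  move=> jk; have jN : (j <= N)%N by lia.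
  have := perturbed_near1 jN; have := partial_le jN; lra.
rewrite FS // !big_ord_recr /=; set T := \sum_(i < k) (x i - g i).
have -> : F k + x k * F k - g k * F k.-1 - 1 - (T + (x k - g k)) =
  (F k - 1 - T) + (x k * (F k - 1) - g k * (F k.-1 - 1)) by ring.
apply: le_trans (cabsD _ _) _.
have h1 := IH (ltnW kN).
have h2 := cabsB (x k * (F k - 1)) (g k * (F k.-1 - 1)).
rewrite !cabsM in h2.
have h3 : cabs (x k) * cabs (F k - 1) <= cabs (x k) * (2 * S).
  by rewrite ler_wpM2l ?cabs_ge0 ?near.
have h4 : cabs (g k) * cabs (F k.-1 - 1) <= cabs (g k) * (2 * S).
  by rewrite ler_wpM2l ?cabs_ge0 ?near ?leq_pred.
rewrite -/T -[s k]/(cabs (x k) + cabs (g k)) in h1 *.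
move: (\sum_(i < k) s i) (S) h1 h2 h3 h4 => T1 S1 h1 h2 h3 h4; lra.
Qed.

End PerturbedRecurrence.

(** * Harmonic numbers *)

Section HarmonicField.
Context {F : numFieldType}.

Definition harmonic_sum (m : nat) : F := \sum_(i < m) i.+1%:R^-1.

Lemma harmonic_sumS m : harmonic_sum m.+1 = harmonic_sum m + m.+1%:R^-1.
Proof. by rewrite /harmonic_sum big_ord_recr. Qed.

Lemma harmonic_sum_ge0 m : 0 <= harmonic_sum m.
Proof. by apply: sumr_ge0 => i _; rewrite invr_ge0. Qed.

(** Partial fractions: m + 1 is the sum of the two factors. *)
Lemma harmonic_convolution (m : nat) :
  \sum_(i < m) (i.+1%:R * (m - i)%:R)^-1 = 2 * harmonic_sum m / m.+1%:R :> F.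
Proof.
have e (i : 'I_m) : true -> (i.+1%:R * (m - i)%:R)^-1 =
    m.+1%:R^-1 * (i.+1%:R^-1 + (m - i)%:R^-1) :> F.
  move=> _; have him : (0 < m - i)%N by have := ltn_ord i; lia.
  have -> : m.+1%:R = i.+1%:R + (m - i)%:R :> F.
    by rewrite -natrD; congr (_%:R); have := ltn_ord i; lia.
  have hp : 0 < i.+1%:R :> F by rewrite ltr0n.
  have hq : 0 < (m - i)%:R :> F by rewrite ltr0n.
  move: (i.+1%:R) ((m - i)%:R) hp hq => p q hp hq.
  by field; rewrite !gt_eqF ?addr_gt0.
rewrite (eq_bigr _ e) -mulr_sumr big_split /= -/(harmonic_sum m).
have -> : \sum_(i < m) (m - i)%:R^-1 = harmonic_sum m.
  rewrite /harmonic_sum (reindex_inj rev_ord_inj) /=.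
  by apply: eq_bigr => i _; congr (_%:R^-1); have := ltn_ord i; lia.
ring.
Qed.

End HarmonicField.

Section HarmonicReal.
Context {R : realType}.

Lemma harmonic_sum_ge1 m : (0 < m)%N -> 1 <= harmonic_sum m :> R.
Proof.
case: m => // m _; rewrite /harmonic_sum big_ord_recl invr1 lerDl.
by apply: sumr_ge0 => i _; rewrite invr_ge0.
Qed.

(** Induction with 1/(m+2) <= - ln (1 - 1/(m+2)) = ln (m+2) - ln (m+1). *)
Lemma harmonic_sum_le m : harmonic_sum m.+1 <= 1 + ln m.+1%:R :> R.
Proof.
elim: m => [|m IH]; first by rewrite /harmonic_sum big_ord1 invr1 ln1 addr0.
rewrite harmonic_sumS.
have h : ln (m.+1%:R / m.+2%:R : R) <= - m.+2%:R^-1.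
  have -> : m.+1%:R / m.+2%:R = 1 + (- m.+2%:R^-1) :> R.
    by field; rewrite ?pnatr_eq0.
  apply: le_ln1Dx; rewrite ltrN2 invf_lt1 ?ltr1n //.
rewrite ln_div ?posrE ?ltr0n // in h.
move: (m.+2%:R^-1) (ln m.+2%:R) (ln m.+1%:R) (harmonic_sum m.+1) h IH.
move=> p q r t; lra.
Qed.

Lemma ln_ge1 (m : nat) : (4 <= m)%N -> 1 <= ln (m%:R : R).
Proof.
move=> m4.
have h2 : 2^-1 <= ln (2 : R).
  (* ln 2 = - ln (1 - 1/2) >= 1/2 *)
  have e : 1 + - 2^-1 = 2^-1 :> R by field.
  rewrite -[X in ln X]invrK -e lnV ?posrE; last by rewrite e invr_gt0.
  have := @le_ln1Dx R (- 2^-1); rewrite ltrN2 invf_lt1 ?ltr1n // => /(_ isT).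
  lra.
have h4 : ln (4 : R) = ln 2 + ln 2.
  by rewrite -lnM ?posrE // -natrM.
have : ln (4 : R) <= ln (m%:R : R).
  by rewrite ler_ln ?posrE ?ltr0n ?ler_nat //; lia.
lra.
Qed.

Lemma harmonic_sum_le_ln (m : nat) : (4 <= m)%N ->
  harmonic_sum m <= 2 * ln (m%:R : R).
Proof.
case: m => // m m4; have := harmonic_sum_le m; have := ln_ge1 m4; lra.
Qed.

Lemma cabs_harmonic_sum m :
  cabs (harmonic_sum m : R[i]) = harmonic_sum m.
Proof.
rewrite -[RHS]ger0_norm ?harmonic_sum_ge0 // -cabs_real; congr cabs.
rewrite /harmonic_sum rmorph_sum; apply: eq_bigr => i _.
by rewrite fmorphV rmorph_nat.
Qed.

End HarmonicReal.
(** * Continuants *)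

Lemma sum_double (V : nmodType) (f : nat -> V) m :
  \sum_(i < 2 * m) f i = \sum_(i < m) (f (2 * i)%N + f (2 * i).+1).
Proof.
elim: m => [|m IH]; first by rewrite muln0 !big_ord0.
by rewrite mulnS !addSn add0n !big_ord_recr /= IH addrA.
Qed.

Lemma prod_double (V : comPzSemiRingType) (f : nat -> V) m :
  \prod_(i < 2 * m) f i = \prod_(i < m) (f (2 * i)%N * f (2 * i).+1).
Proof.
elim: m => [|m IH]; first by rewrite muln0 !big_ord0.
by rewrite mulnS !addSn add0n !big_ord_recr /= IH mulrA.
Qed.

Section LevelDenominators.
Variable m : nat.

(** At time k the walk is at the level l with w_k = n - 2 l, n = 2m + 1, and
    k and l have the same parity.  The denominator of the walk is then
    n + w_k = 2n - 2l for odd l and n - w_k = 2l for even l. *)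
Definition level_den (k : nat) : nat :=
  if odd k then (2 * (2 * m + 1) - 2 * k)%N else (2 * k)%N.

Lemma level_den_gt0 k : (1 <= k <= 2 * m)%N -> (0 < level_den k)%N.
Proof. by rewrite /level_den; case: ifP => h; lia. Qed.

Lemma level_den_even t : level_den (2 * t) = (4 * t)%N.
Proof. by rewrite /level_den mul2n odd_double; lia. Qed.

Lemma level_den_even2 t : level_den (2 * t).+2 = (4 * t.+1)%N.
Proof. by rewrite -level_den_even; congr level_den; lia. Qed.

Lemma level_den_odd t : level_den (2 * t).+1 = (4 * (m - t))%N.
Proof. by rewrite /level_den /= mul2n odd_double /=; lia. Qed.

Variable F : numFieldType.

(** Odd and even levels run through the same denominators 4, 8, ..., 4m, in
    opposite orders. *)
Lemma sum_level_den :
  \sum_(i < 2 * m) (level_den i.+1)%:R^-1 = harmonic_sum m / 2 :> F.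
Proof.
rewrite (sum_double (fun i => (level_den i.+1)%:R^-1)).
under eq_bigr => i _ do rewrite level_den_odd level_den_even2.
rewrite big_split /= (reindex_inj rev_ord_inj) /= -big_split /=.
rewrite /harmonic_sum mulr_suml; apply: eq_bigr => i _.
have -> : (m - (m - i.+1) = i.+1)%N by have := ltn_ord i; lia.
by rewrite natrM; field; rewrite ?pnatr_eq0.
Qed.

Lemma sum_level_den_odd : (0 < m)%N ->
  \sum_(i < m) ((level_den (2 * i))%:R * (level_den (2 * i).+1)%:R)^-1 =
  harmonic_sum m.-1 / (8 * m%:R) :> F.
Proof.
move=> m0.
under eq_bigr => i _ do rewrite level_den_odd level_den_even.
case: m m0 => // k _; rewrite big_ord_recl muln0 mul0r invr0 add0r /=.
transitivity (16^-1 * \sum_(i < k) (i.+1%:R * (k - i)%:R)^-1 : F).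
  rewrite mulr_sumr; apply: eq_bigr => i _.
  rewrite /bump add1n subSS !natrM; have : (k - i)%:R != 0 :> F.
    by rewrite pnatr_eq0; have := ltn_ord i; lia.
  have : i.+1%:R != 0 :> F by rewrite pnatr_eq0.
  by move: ((k - i)%:R) (i.+1%:R) => p q q0 p0; field; rewrite p0 q0.
by rewrite harmonic_convolution; field; rewrite ?natr1 ?nat1r pnatr_eq0.
Qed.

Lemma sum_level_den_even :
  \sum_(i < m) ((level_den (2 * i).+1)%:R * (level_den (2 * i).+2)%:R)^-1 =
  harmonic_sum m / (8 * m.+1%:R) :> F.
Proof.
under eq_bigr => i _ do rewrite level_den_odd level_den_even2.
transitivity (16^-1 * \sum_(i < m) (i.+1%:R * (m - i)%:R)^-1 : F).
  rewrite mulr_sumr; apply: eq_bigr => i _.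
  rewrite !natrM; have : (m - i)%:R != 0 :> F.
    by rewrite pnatr_eq0; have := ltn_ord i; lia.
  have : i.+1%:R != 0 :> F by rewrite pnatr_eq0.
  by move: ((m - i)%:R) (i.+1%:R) => p q q0 p0; field; rewrite p0 q0.
by rewrite harmonic_convolution; field; rewrite ?natr1 ?nat1r pnatr_eq0.
Qed.

Lemma prod_level_den :
  \prod_(i < 2 * m) (level_den i.+1)%:R = 4 ^+ (2 * m) * m`!%:R ^+ 2 :> F.
Proof.
have prod_fact k : \prod_(i < k) (4 * i.+1)%:R = 4 ^+ k * k`!%:R :> F.
  elim: k => [|k IH]; first by rewrite big_ord0 mulr1.
  by rewrite big_ord_recr /= IH factS exprS !natrM; ring.
rewrite (prod_double (fun i => (level_den i.+1)%:R)).
under eq_bigr => i _ do rewrite level_den_odd level_den_even2.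
rewrite big_split /= (reindex_inj rev_ord_inj) /= prod_fact.
have -> : \prod_(i < m) (4 * (m - (m - i.+1)))%:R = 4 ^+ m * m`!%:R :> F.
  rewrite -prod_fact; apply: eq_bigr => i _.
  by congr ((4 * _)%:R); have := ltn_ord i; lia.
by rewrite mul2n -addnn exprD; ring.
Qed.

End LevelDenominators.

Section Continuant.
Context {R : realType}.
Variables (m : nat) (a A b B z : R[i]).
Hypothesis m0 : (0 < m)%N.

Definition level_weight (k : nat) : R[i] := (level_den m k)%:R + z.

(** Weights of a step from level k to level k + 1, towards -n, and to level
    k - 1: a Fourier coefficient of P at even times, of Q at odd times. *)
Definition down (k : nat) : R[i] := if odd k then b else a.
Definition up (k : nat) : R[i] := if odd k then B else A.

(** Determinant of the k by k tridiagonal matrix with diagonal entries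
    level_weight 1, ..., level_weight k and off-diagonal entries - down, - up. *)
Fixpoint continuant (k : nat) : R[i] :=
  if k is k1.+1 then
    level_weight k * continuant k1 -
    (if k1 is k2.+1 then up k * down k1 * continuant k2 else 0)
  else 1.

Definition normalized_continuant (k : nat) : R[i] :=
  continuant k / \prod_(i < k) (level_den m i.+1)%:R.

Let x (k : nat) : R[i] := z / (level_den m k.+1)%:R.
(* for k = 0 the denominator level_den m 0 vanishes, hence so does g 0 *)
Let g (k : nat) : R[i] :=
  up k.+1 * down k / ((level_den m k)%:R * (level_den m k.+1)%:R).

Let normalized_continuant0 : normalized_continuant 0 = 1.
Proof. by rewrite /normalized_continuant big_ord0 divr1. Qed.

Lemma normalized_continuantS k : (k < 2 * m)%N ->
  normalized_continuant k.+1 = normalized_continuant k +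
    x k * normalized_continuant k - g k * normalized_continuant k.-1.
Proof.
move=> km; have dn0 i : (i < k.+1)%N -> (level_den m i.+1)%:R != 0 :> R[i].
  by move=> ik; rewrite pnatr_eq0 -lt0n level_den_gt0 //; lia.
have P0 j : (j <= k.+1)%N -> \prod_(i < j) (level_den m i.+1)%:R != 0 :> R[i].
  move=> jk; apply/prodf_neq0 => i _; apply: dn0; exact: leq_trans jk.
rewrite /normalized_continuant /x /g /level_weight big_ord_recr /=.
case: k km dn0 P0 => [|k] km dn0 P0.
  rewrite big_ord0 /= /level_weight /g /level_den /= mul0r invr0 mulr0 mul0r.
  by field; exact: (dn0 0%N).
have h0 := dn0 k; have h1 := dn0 k.+1; have := P0 k.
rewrite big_ord_recr /= => h2; rewrite /level_weight.
move: (\prod_(i < k) _) h2 => P h2.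
by field; rewrite h0 ?h1 ?h2 //; lia.
Qed.

Let up_down_even t : up (2 * t).+1 * down (2 * t) = a * B.
Proof. by rewrite /up /down /= mul2n odd_double mulrC. Qed.

Let up_down_odd t : up (2 * t).+2 * down (2 * t).+1 = A * b.
Proof. by rewrite /up /down /= mul2n odd_double. Qed.

Let sum_x : \sum_(i < 2 * m) x i = z * harmonic_sum m / 2.
Proof. by rewrite -mulr_sumr sum_level_den mulrA. Qed.

Let sum_g : \sum_(i < 2 * m) g i =
  A * b * (harmonic_sum m / (8 * m.+1%:R)) +
  a * B * (harmonic_sum m.-1 / (8 * m%:R)).
Proof.
rewrite (sum_double g) /g.
under eq_bigr => i _ do rewrite up_down_even up_down_odd.
by rewrite big_split -!mulr_sumr sum_level_den_even sum_level_den_odd // addrC.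
Qed.

Let P : R := cabs (a * B) + cabs (A * b).

Let harmonic_pred_le : harmonic_sum m.-1 <= harmonic_sum m :> R.
Proof.
by case: m m0 => //= k _; rewrite harmonic_sumS lerDl invr_ge0.
Qed.

Let m_gt0 : 0 < m%:R :> R. Proof. by rewrite ltr0n. Qed.

Let size_bound : R := harmonic_sum m * (cabs z / 2 + P / (8 * m%:R)).

Let sum_size :
  \sum_(i < 2 * m) (cabs (x i) + cabs (g i)) <= size_bound.
Proof.
rewrite big_split /=.
have -> : \sum_(i < 2 * m) cabs (x i) = harmonic_sum m * (cabs z / 2).
  under eq_bigr => i _ do rewrite /x cabsM cabsV cabs_nat.
  by rewrite -mulr_sumr sum_level_den; ring.
rewrite /size_bound mulrDr lerD2l (sum_double (fun i => cabs (g i))).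
under eq_bigr => i _ do rewrite /g up_down_even up_down_odd !cabsM !cabsV
  !cabsM !cabs_nat.
rewrite big_split -!mulr_sumr sum_level_den_even sum_level_den_odd //=.
have h1 : harmonic_sum m.-1 / (8 * m%:R) <= harmonic_sum m / (8 * m%:R) :> R.
  by rewrite ler_wpM2r // invr_ge0 mulr_ge0.
have h2 : harmonic_sum m / (8 * m.+1%:R) <= harmonic_sum m / (8 * m%:R) :> R.
  rewrite ler_wpM2l ?harmonic_sum_ge0 // lef_pV2 ?posrE ?mulr_gt0 //.
  by rewrite ler_pM2l ?ler_nat.
apply: (@le_trans _ _ (P * (harmonic_sum m / (8 * m%:R)))); last first.
  by rewrite le_eqVlt; apply/orP; left; apply/eqP; ring.
rewrite /P !cabsM [leRHS]mulrDl; apply: lerD; apply: ler_wpM2l => //.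
  by rewrite mulr_ge0 ?cabs_ge0.
by rewrite mulr_ge0 ?cabs_ge0.
Qed.

(** The upper bound size_bound for sum (|x k| + |g k|) is O(log m / m) as soon
    as z = O(1 / m). *)
Lemma continuant_near1 : size_bound <= 2^-1 ->
  cabs (normalized_continuant (2 * m) - 1) <= 2 * size_bound.
Proof.
move=> hS; have h := perturbed_near1 normalized_continuant0
  normalized_continuantS (le_trans sum_size hS) (leqnn _).
by apply: le_trans h _; rewrite ler_wpM2l // sum_size.
Qed.

(** Both sums are multiples of H_m up to O(log m / m^2), which is what makes
    them cancel at z = (A b + a B) / (4m). *)
Lemma continuant_first_order : size_bound <= 2^-1 ->
  cabs (normalized_continuant (2 * m) - 1) <=
  harmonic_sum m / 2 * cabs (z - (A * b + a * B) / (4 * m%:R)) +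
  P * harmonic_sum m / (8 * m%:R ^+ 2) + 2 * size_bound ^+ 2.
Proof.
move=> hS.
have h := perturbed_first_order normalized_continuant0
  normalized_continuantS (le_trans sum_size hS) (leqnn _).
have S0 : 0 <= \sum_(i < 2 * m) (cabs (x i) + cabs (g i)).
  by apply: sumr_ge0 => i _; rewrite addr_ge0 ?cabs_ge0.
have h1 : 2 * (\sum_(i < 2 * m) (cabs (x i) + cabs (g i))) *
    (\sum_(i < 2 * m) (cabs (x i) + cabs (g i))) <= 2 * size_bound ^+ 2.
  by rewrite -mulrA ler_wpM2l // expr2 ler_pM // sum_size.
have {}h := le_trans h h1; rewrite sumrB sum_x sum_g in h.
set F := normalized_continuant _ in h *.
have e : F - 1 = (F - 1 - (z * harmonic_sum m / 2 -
   (A * b * (harmonic_sum m / (8 * m.+1%:R)) +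
    a * B * (harmonic_sum m.-1 / (8 * m%:R))))) +
   harmonic_sum m / 2 * (z - (A * b + a * B) / (4 * m%:R)) +
   (A * b * (harmonic_sum m / (8 * m.+1%:R * m%:R)) +
    a * B * (1 / (8 * m%:R ^+ 2))).
  have mC : m%:R != 0 :> R[i] by rewrite pnatr_eq0 -lt0n.
  have -> : harmonic_sum m.-1 = harmonic_sum m - m%:R^-1 :> R[i].
    by case: (m) m0 => // k _; rewrite harmonic_sumS addrK.
  by field; rewrite mC ?natr1 ?nat1r pnatr_eq0.
rewrite e; apply: le_trans (cabsD _ _) _.
have h2 := cabsD (F - 1 - (z * harmonic_sum m / 2 -
   (A * b * (harmonic_sum m / (8 * m.+1%:R)) +
    a * B * (harmonic_sum m.-1 / (8 * m%:R)))))
   (harmonic_sum m / 2 * (z - (A * b + a * B) / (4 * m%:R))).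
have h3 : cabs (harmonic_sum m / 2 * (z - (A * b + a * B) / (4 * m%:R))) =
  harmonic_sum m / 2 * cabs (z - (A * b + a * B) / (4 * m%:R)).
  by rewrite !cabsM cabsV (cabs_nat 2) cabs_harmonic_sum.
have h4 : cabs (A * b * (harmonic_sum m / (8 * m.+1%:R * m%:R)) +
    a * B * (1 / (8 * m%:R ^+ 2))) <= P * harmonic_sum m / (8 * m%:R ^+ 2).
  apply: le_trans (cabsD _ _) _.
  have H1 := @harmonic_sum_ge1 R _ m0.
  have iv0 : 0 <= (8 * m%:R ^+ 2)^-1 :> R by rewrite invr_ge0 mulr_ge0.
  have -> : P * harmonic_sum m / (8 * m%:R ^+ 2) =
    cabs (A * b) * (harmonic_sum m / (8 * m%:R ^+ 2)) +
    cabs (a * B) * (harmonic_sum m / (8 * m%:R ^+ 2)) by rewrite /P; ring.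
  apply: lerD; rewrite cabsM; apply: ler_wpM2l; rewrite ?cabs_ge0 //.
    rewrite cabsM cabsV !cabsM !cabs_nat cabs_harmonic_sum.
    rewrite ler_wpM2l ?harmonic_sum_ge0 // lef_pV2 ?posrE ?mulr_gt0 ?exprn_gt0 //.
    by rewrite -mulrA ler_pM2l // expr2 ler_pM2r // ler_nat.
  rewrite cabsM cabs1 cabsV cabsM expr2 cabsM !cabs_nat -expr2.
  by rewrite ler_wpM2r.
rewrite h3 in h2; lra.
Qed.

End Continuant.

(** * Sums over lattice paths *)

Section PathSum.
Context {R : realType}.
Variables (m : nat) (a A b B z : R[i]).
Hypothesis m0 : (0 < m)%N.

Let D : nat -> R[i] := level_weight m z.
Let dn : nat -> R[i] := down a b.
Let u : nat -> R[i] := up A B.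
Let K : nat -> R[i] := continuant m a A b B z.

(** One step of the walk, from level l to a level inside [1, 2m], with the
    denominator of the level reached. *)
Definition transfer (f : nat -> R[i]) (l : nat) : R[i] :=
  (if (l < 2 * m)%N then dn l / D l.+1 * f l.+1 else 0) +
  (if (1 < l)%N then u l / D l.-1 * f l.-1 else 0).

Definition exit_weight (l : nat) : R[i] := if l == (2 * m)%N then dn l else 0.

(** Sum over the paths from level l to level 2m + 1 through L levels in
    [1, 2m]. *)
Definition path_sum (L : nat) : nat -> R[i] := iter L transfer exit_weight.

Lemma path_sum_parity L l : (l <= 2 * m)%N -> odd L != odd l ->
  path_sum L l = 0.
Proof.
elim: L l => [|L IH] l lm h /=.
  rewrite /exit_weight; case: eqP => // e; move: h; rewrite e; lia.
rewrite /transfer; case: ifP => h1; case: ifP => h2;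
  rewrite ?IH ?mulr0 ?addr0 //; lia.
Qed.

Lemma transferB f g l :
  transfer (fun k => f k - g k) l = transfer f l - transfer g l.
Proof. by rewrite /transfer; do 2 case: ifP => _; ring. Qed.

Lemma eq_transfer f g l : (l <= 2 * m)%N ->
  (forall k, (k <= 2 * m)%N -> f k = g k) -> transfer f l = transfer g l.
Proof.
by move=> lm h; rewrite /transfer; do 2 case: ifP => ?; rewrite ?h //; lia.
Qed.

Section Contraction.
Variable C : R.
Hypothesis aC : cabs a <= C.
Hypothesis AC : cabs A <= C.
Hypothesis bC : cabs b <= C.
Hypothesis BC : cabs B <= C.
Hypothesis z1 : cabs z <= 1.
Hypothesis C_le : 2 * C ^+ 2 <= m.-1%:R.

Lemma level_den_adjacent k : (0 < k < 2 * m)%N ->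
  (16 * m.-1 <= level_den m k * level_den m k.+1)%N.
Proof.
move=> km; have [[t e]|[t e]] : (exists t, k = (2 * t)%N) \/ (exists t, k = (2 * t).+1)%N.
- case: (boolP (odd k)) => ok; [right|left]; exists k./2; lia.
- by rewrite e level_den_even level_den_odd; nia.
- by rewrite e level_den_even2 level_den_odd; nia.
Qed.

Let D_ge k : (0 < k <= 2 * m)%N -> (level_den m k)%:R / 2 <= cabs (D k).
Proof.
move=> km; have d2 : (2 <= level_den m k)%N.
  by have := level_den_gt0 km; rewrite /level_den; case: ifP; lia.
have := cabs_sub_ge (level_den m k)%:R z; rewrite cabs_nat.
have : 2 <= (level_den m k)%:R :> R by rewrite (ler_nat R 2).
rewrite /D /level_weight; move: z1; lra.
Qed.

Lemma level_weight_neq0 k : (0 < k <= 2 * m)%N -> D k != 0.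
Proof.
move=> km; rewrite -cabs_eq0 gt_eqF //; apply: lt_le_trans (D_ge km).
by rewrite divr_gt0 // ltr0n level_den_gt0.
Qed.

Let dn_le k : cabs (dn k) <= C.
Proof. by rewrite /dn /down; case: ifP. Qed.

Let u_le k : cabs (u k) <= C.
Proof. by rewrite /u /up; case: ifP. Qed.

Let two_steps k k' (c c' w : R[i]) (M : R) :
  (0 < k <= 2 * m)%N -> (0 < k' <= 2 * m)%N -> k = k'.+1 \/ k' = k.+1 ->
  cabs c <= C -> cabs c' <= C -> cabs w <= M ->
  cabs (c / D k * (c' / D k' * w)) <= M / 8.
Proof.
move=> km km' kk' cC cC' wM.
have M0 : 0 <= M by apply: le_trans wM; exact: cabs_ge0.
have den : 4 * m.-1%:R <= cabs (D k) * cabs (D k').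
  apply: (@le_trans _ _ ((level_den m k)%:R / 2 * ((level_den m k')%:R / 2))).
    have : (16 * m.-1 <= level_den m k * level_den m k')%N.
      case: kk' => e; subst; last first.
        by apply: level_den_adjacent; clear -km km'; lia.
      rewrite [X in (_ <= X)%N]mulnC.
      by apply: level_den_adjacent; clear -km km'; lia.
    rewrite -(ler_nat R) !natrM; lra.
  by apply: ler_pM; rewrite ?D_ge // divr_ge0.
have Dk := level_weight_neq0 km; have Dk' := level_weight_neq0 km'.
have DD : 0 < cabs (D k) * cabs (D k').
  by rewrite mulr_gt0 // lt_def cabs_ge0 cabs_eq0 ?Dk ?Dk'.
have -> : cabs (c / D k * (c' / D k' * w)) =
   cabs c * cabs c' * cabs w / (cabs (D k) * cabs (D k')).
  rewrite !cabsM !cabsV; move: DD; rewrite lt0r mulf_eq0 => /andP[/norP[h1 h2] _].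
  by field; rewrite h1 h2.
rewrite ler_pdivrMr //.
have h1 : cabs c * cabs c' <= C ^+ 2 by rewrite expr2 ler_pM ?cabs_ge0.
have h2 : C ^+ 2 <= (cabs (D k) * cabs (D k')) / 8 by move: C_le; lra.
have -> : M / 8 * (cabs (D k) * cabs (D k')) =
   cabs (D k) * cabs (D k') / 8 * M by ring.
by apply: ler_pM; rewrite ?mulr_ge0 ?cabs_ge0 // (le_trans h1).
Qed.

(** Small denominators sit at even levels near 0 and at odd levels near 2m, so
    of two neighbouring levels one has a denominator of order m. *)
Lemma transfer_contraction f M l : (l <= 2 * m)%N ->
  (forall k, (0 < k <= 2 * m)%N -> cabs (f k) <= M) ->
  cabs (transfer (transfer f) l) <= M / 2.
Proof.
move=> lm fM.
have M0 : 0 <= M by apply: le_trans (fM 1%N _); rewrite ?cabs_ge0 //; lia.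
have zero : cabs (0 : R[i]) <= M / 8 by rewrite cabs0 divr_ge0.
have half k c : (0 < k <= 2 * m)%N -> cabs c <= C -> (k <= l.+1)%N -> (l <= k.+1)%N ->
    k != l -> cabs (c / D k * transfer f k) <= M / 4.
  move=> km cC kl lk nkl; rewrite /transfer mulrDr.
  apply: le_trans (cabsD _ _) _; have -> : M / 4 = M / 8 + M / 8 by field.
  apply: lerD; case: ifP => h; rewrite ?mulr0 //.
    by apply: two_steps => //; rewrite ?dn_le ?fM //; clear -km h; lia.
  by apply: two_steps => //; rewrite ?u_le ?fM //; clear -km h; lia.
rewrite {1}/transfer; apply: le_trans (cabsD _ _) _.
have -> : M / 2 = M / 4 + M / 4 by field.
have zero4 : cabs (0 : R[i]) <= M / 4 by rewrite cabs0 divr_ge0.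
apply: lerD; case: ifP => // h.
  by apply: half; rewrite ?dn_le //; clear -lm h; lia.
by apply: half; rewrite ?u_le //; clear -lm h; lia.
Qed.

Hypothesis K0 : K (2 * m) != 0.

(* Cramer's rule for the tridiagonal system Z = exit_weight + transfer Z: the
   cofactor of a corner splits into a continuant and a product of down's *)
Let V (l : nat) : R[i] :=
  K l.-1 * \prod_(l <= i < (2 * m).+1) dn i / K (2 * m).

Let Z (l : nat) : R[i] := if l is 0 then dn 0 * V 1 else D l * V l.

Let V_last : V (2 * m).+1 = (K (2 * m)) / K (2 * m).
Proof. by rewrite /V big_geq // mulr1. Qed.

Let V_rec l : (0 < l <= 2 * m)%N ->
  D l * V l = dn l * V l.+1 + (if (1 < l)%N then u l * V l.-1 else 0).
Proof.
case: l => // l /andP[_ lm].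
have e1 : \prod_(l.+1 <= i < (2 * m).+1) dn i =
    dn l.+1 * \prod_(l.+2 <= i < (2 * m).+1) dn i by rewrite big_ltn.
rewrite /V /= e1; move: (\prod_(l.+2 <= i < _) _) e1 => Q e1.
rewrite /K /= -/K -/D; case: l lm e1 => [|l] lm e1 /=; first by ring.
rewrite [X in u _ * (_ * X / _)]big_ltn 1?ltnW // e1 -/(u l.+2) -/(dn l.+1).
rewrite -/(K l); ring.
Qed.

Let Z_fixed l : (l <= 2 * m)%N -> Z l = exit_weight l + transfer Z l.
Proof.
move=> lm; have D0 k : (0 < k <= 2 * m)%N -> D k != 0 := @level_weight_neq0 k.
rewrite /transfer /exit_weight; case: l lm => [|l] lm.
  have -> : (0 == 2 * m)%N = false by lia.
  rewrite add0r addr0 ifT; last lia.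
  by rewrite /Z; field; apply: D0; lia.
rewrite {1}/Z V_rec; last lia.
have -> : (if (1 < l.+1)%N then u l.+1 / D l.+1.-1 * Z l.+1.-1 else 0) =
    (if (1 < l.+1)%N then u l.+1 * V l.+1.-1 else 0).
  case: ifP => // h; case: l lm h => // l lm _ /=.
  by field; apply: D0; lia.
rewrite addrA; congr (_ + _); case: eqP => [e|ne].
  by rewrite e V_last divff // ltnn addr0 mulr1.
rewrite add0r ifT; last lia.
by rewrite /Z; field; apply: D0; lia.
Qed.

Let partial_sum N l : R[i] := \sum_(L < N) path_sum L l.

Let transfer_sum N l : transfer (partial_sum N) l =
  \sum_(L < N) path_sum L.+1 l.
Proof.
elim: N => [|N IH].
  rewrite /transfer /partial_sum !big_ord0 !mulr0.
  by do 2 case: ifP => _; rewrite addr0.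
rewrite big_ord_recr /= -IH /transfer /partial_sum !big_ord_recr /=.
by do 2 case: ifP => _; ring.
Qed.

Let remainder N l : R[i] := Z l - partial_sum N l.

Let remainderS N l : (l <= 2 * m)%N -> remainder N.+1 l = transfer (remainder N) l.
Proof.
move=> lm; rewrite /remainder transferB transfer_sum {1}/partial_sum.
by rewrite big_ord_recl /= Z_fixed //=; ring.
Qed.

(** The remainders of the Neumann series are Z, transfer Z, transfer^2 Z, ... *)
Lemma path_sum_converges : exists M : R, forall N,
  cabs (a * \prod_(1 <= i < (2 * m).+1) dn i / K (2 * m)
        - \sum_(L < 2 * N) path_sum L 0) <= M / 2 ^+ N.
Proof.
pose M : R := \sum_(l < (2 * m).+1) cabs (Z l).
have ZM l : (l <= 2 * m)%N -> cabs (Z l) <= M.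
  move=> lm; rewrite /M (bigD1 (Ordinal (lm : (l < (2 * m).+1)%N))) //=.
  by rewrite lerDl sumr_ge0 // => i _; exact: cabs_ge0.
exists M => N.
suff h l : (l <= 2 * m)%N -> cabs (remainder (2 * N) l) <= M / 2 ^+ N.
  have := h 0%N isT; rewrite /remainder /partial_sum /Z /V /=.
  by rewrite mul1r mulrA.
elim: N l => [|N IH] l lm.
  by rewrite /remainder /partial_sum muln0 big_ord0 subr0 expr0 divr1 ZM.
have -> : (2 * N.+1 = (2 * N).+2)%N by lia.
rewrite remainderS // (@eq_transfer _ (transfer (remainder (2 * N)))) //; last first.
  by move=> k km; exact: remainderS.
have -> : M / 2 ^+ N.+1 = M / 2 ^+ N / 2.
  by rewrite exprS invfM mulrA mulrAC.
by apply: transfer_contraction => // k /andP[_ km]; exact: IH.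
Qed.

End Contraction.

Lemma prod_down : \prod_(1 <= i < (2 * m).+1) dn i = (a * b) ^+ m.
Proof.
rewrite big_add1 /= big_mkord (prod_double (fun i => dn i.+1)).
under eq_bigr => i _ do rewrite /dn /down /= mul2n odd_double /=.
by rewrite big_const_ord iter_mulr_1 mulrC.
Qed.

End PathSum.

(** * From index tuples to lattice paths *)

Lemma sum_cons_tuple (V : nmodType) (T : finType) (L : nat)
    (F : seq T -> V) :
  \sum_(t : L.+1.-tuple T) F t = \sum_(i : T) \sum_(t : L.-tuple T) F (i :: t).
Proof.
rewrite pair_big /=.
rewrite (reindex (fun p : T * L.-tuple T => cons_tuple p.1 p.2)) //=.
exists (fun t : L.+1.-tuple T => (thead t, behead_tuple t)) => [[i t] _|t _] /=.
  by congr (_, _); apply: val_inj.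
by rewrite [RHS]tuple_eta; apply: val_inj.
Qed.

Lemma sum_ord_if (V : nmodType) (N l : nat) (G : nat -> V) :
  \sum_(i < N) (if (i == l :> nat) then G i else 0) =
  if (l < N)%N then G l else 0.
Proof.
case: ifP => lN.
  rewrite (bigD1 (Ordinal lN)) //= eqxx big1 ?addr0 // => i.
  by rewrite -val_eqE /= => /negbTE ->.
apply: big1 => i _; case: eqP => // e.
by move: (ltn_ord i); rewrite e lN.
Qed.

Section IndexTuples.
Context {R : realType}.
Variables (a A b B z : R[i]) (n : int).

Definition edge (k : nat) (c d : int) : R[i] :=
  if odd k then coef2 b B (c + d) else coef2 a A (- c - d).

(** The terms of the series for beta_n^-, unrolled along the tuple: c is the
    index at time k, and s lists the next ones. *)
Fixpoint walk_weight (k : nat) (c : int) (s : seq int) : R[i] :=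
  if s is d :: s' then
    edge k c d / ((n - d)%:~R + z) * walk_weight k.+1 d s'
  else edge k c n.

Lemma walk_weightE k c s :
  (\prod_(0 <= i < (size s).+1)
     edge (k + i) (nth 0 (c :: rcons s n) i) (nth 0 (rcons s n) i)) /
  \prod_(d <- s) ((n - d)%:~R + z) = walk_weight k c s.
Proof.
elim: s k c => [|d s IH] k c /=.
  by rewrite big_nat1 big_nil divr1 addn0.
rewrite big_nat_recl // big_cons /= addn0 -IH invfM.
under eq_bigr => i _ do rewrite addnS -addSn.
ring.
Qed.

Lemma beta_minus_termE nu (j : (2 * nu).-tuple int) :
  beta_minus_term a A b B n z j = walk_weight 0 n j.
Proof.
rewrite -walk_weightE /beta_minus_term size_tuple; congr (_ / _).
by rewrite big_tuple.
Qed.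

End IndexTuples.

Section Levels.
Context {R : realType}.
Variables (m : nat) (a A b B z : R[i]).
Hypothesis m0 : (0 < m)%N.

Let n : int := (2 * m + 1)%N%:Z.

(** The index j_k sits at level l when (-1)^k j_k = n - 2 l. *)
Definition at_level (k : nat) (l : int) : int :=
  if odd k then - (n - 2 * l) else n - 2 * l.

Let weight := walk_weight a A b B z n.

Lemma edge_at_level k (l l' : int) :
  edge a A b B k (at_level k l) (at_level k.+1 l') =
  if l' == l + 1 then down a b k else if l == l' + 1 then up A B k else 0.
Proof.
rewrite /edge /at_level /coef2 /down /up /=.
by case: (odd k) => /=; do ?[case: eqP => ?] => //; lia.
Qed.

Fixpoint index_of_levels (k : nat) (x : seq 'I_(2 * m)) : seq int :=
  if x is i :: x' then at_level k.+1 i.+1 :: index_of_levels k.+1 x' else [::].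

Lemma size_index_of_levels k x : size (index_of_levels k x) = size x.
Proof. by elim: x k => //= i x IH k; rewrite IH. Qed.

Lemma index_of_levels_inj k : injective (index_of_levels k).
Proof.
move=> x; elim: x k => [|i x IH] k [|i' x'] //= [e /IH ->]; congr (_ :: _).
by apply: val_inj => /=; move: e; rewrite /at_level /=; case: (odd k) => /=; lia.
Qed.

Lemma index_of_levels_mem k x d : d \in index_of_levels k x ->
  d <> n /\ (d = n %[mod 2])%Z.
Proof.
elim: x k => //= i x IH k; rewrite inE => /orP[/eqP ->|/IH //].
by have := ltn_ord i; rewrite /at_level /n; case: (odd _) => h; lia.
Qed.

(** Along a path the parities of time and level agree, so the weights, which
    depend on time, can be read off from the level. *)
Lemma sum_index_of_levels L k (l : nat) : (l <= 2 * m)%N -> odd k = odd l ->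
  ~~ odd (k + L) ->
  \sum_(x : L.-tuple 'I_(2 * m)) weight k (at_level k l) (index_of_levels k x) =
  path_sum m a A b B z L l.
Proof.
elim: L k l => [|L IH] k l lm kl kL.
  rewrite (eq_bigr (fun=> edge a A b B k (at_level k l) n)); last first.
    by move=> x _; rewrite (tuple0 x).
  rewrite big_const card_tuple expn0 iter_addr_0.
  have -> : n = at_level k.+1 (2 * m + 1)%N%:Z.
    by rewrite /at_level /= /n; case: ifP; lia.
  rewrite edge_at_level /path_sum /= /exit_weight /down kl.
  do ?[case: eqP => ?] => //; lia.
rewrite (@sum_cons_tuple _ _ _ (fun x => weight k (at_level k l) (index_of_levels k x))) /=.
pose G1 i := down a b l / level_weight m z i.+1 * path_sum m a A b B z L i.+1.
pose G2 i := up A B l / level_weight m z i.+1 * path_sum m a A b B z L i.+1.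
transitivity (\sum_(i < 2 * m) ((if (i == l :> nat) then G1 i else 0) +
   (if (i == l.-2 :> nat) then (if (1 < l)%N then G2 i else 0) else 0))).
  apply: eq_bigr => i _; rewrite -mulr_sumr edge_at_level.
  have den : odd i = odd k -> (n - at_level k.+1 i.+1)%:~R + z =
      level_weight m z i.+1.
    move=> ik; rewrite /level_weight /level_den /at_level /= ik.
    congr (_ + _); rewrite -[RHS]/((_%:Z)%:~R); congr (_%:~R).
    by have := ltn_ord i; rewrite /n; case: (odd k) => /= h; lia.
  have [e1|ne1] := eqVneq (i : nat) l.
    have lm1 : (l < 2 * m)%N by rewrite -e1.
    move: den; rewrite e1 ifT => [den|]; last by apply/eqP; lia.
    have -> : (if l == l.-2 then if (1 < l)%N then G2 l else 0 else 0) = 0.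
      by case: eqP => // e2; rewrite ifF //; lia.
    rewrite den ?IH ?addr0 /G1 /down ?kl //; lia.
  rewrite ifF; last by apply/eqP; move/eqP: ne1; lia.
  case: ifP => [/eqP e2|/eqP ne2].
    rewrite ifT; last by apply/eqP; lia.
    rewrite ifT; last lia.
    by rewrite den ?IH /G2 /up ?kl ?add0r //; lia.
  rewrite !mul0r; case: eqP => e3; rewrite ?ifF ?addr0 //; lia.
rewrite big_split /= sum_ord_if
  (sum_ord_if _ l.-2 (fun i => if (1 < l)%N then G2 i else 0)) /path_sum /=.
rewrite -/(path_sum m a A b B z L) /transfer.
congr (_ + _); case: (ltnP 1 l) => h; last by case: ifP.
rewrite ifT; last lia.
by rewrite /G2; have -> : l.-2.+1 = l.-1 by lia.
Qed.

Lemma edge_neq0 k (l : int) d : edge a A b B k (at_level k l) d != 0 ->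
  d = at_level k.+1 (l + 1) \/ d = at_level k.+1 (l - 1).
Proof.
rewrite /edge /at_level /coef2 /=.
case: (odd k) => /=.
  case: ifP => [/eqP e _|_]; first by left; lia.
  by case: ifP => [/eqP e _|_]; [right; lia|rewrite eqxx].
case: ifP => [/eqP e _|_]; first by left; lia.
by case: ifP => [/eqP e _|_]; [right; lia|rewrite eqxx].
Qed.

Let exit_at_level k : ~~ odd k -> n = at_level k.+1 (2 * m + 1)%N%:Z.
Proof. by move=> /negbTE kL; rewrite /at_level /= kL /= /n; lia. Qed.

(** Below level 0 the walk is trapped: it could only return through level 0,
    at an even time, which is the forbidden index n. *)
Lemma weight_below k p s : odd k = odd p.+1 -> ~~ odd (k + size s) ->
  {in s, forall d, d <> n} -> weight k (at_level k (- p.+1%:Z)) s = 0.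
Proof.
elim: s k p => [|d s IH] k p kp ks sn /=.
  rewrite (exit_at_level (k := k)) ?edge_at_level; last by move: ks; rewrite addn0.
  by do ?[case: eqP => ?] => //; lia.
have [->|/edge_neq0 h] := eqVneq (edge a A b B k (at_level k (- p.+1%:Z)) d) 0.
  by rewrite !mul0r.
have {}IH q : odd q = ~~ odd p -> d = at_level k.+1 (- q.+1%:Z) ->
    weight k.+1 d s = 0.
  move=> qp ->; apply: IH => [||e es]; [by rewrite /= kp /= qp| |].
    by move: ks; rewrite /= addnS.
  by apply: sn; rewrite inE es orbT.
case: h => h; last by rewrite (IH p.+1) ?mulr0 // h; congr at_level; lia.
case: p kp IH h => [|p] kp IH h; last first.
  by rewrite (IH p) ?mulr0 //= ?negbK // h; congr at_level; lia.
case: (sn d); rewrite ?inE ?eqxx // h /at_level /= kp /=; lia.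
Qed.

(** Level 0 is forbidden since it is reached at even times only, where it means
    j = n; level 2m + 1 is reached at odd times only, where it also means
    j = n. *)
Lemma weight_support k (l : nat) s : (l <= 2 * m)%N -> odd k = odd l ->
  ~~ odd (k + size s) -> {in s, forall d, d <> n} ->
  weight k (at_level k l) s != 0 -> exists x, s = index_of_levels k x.
Proof.
elim: s k l => [|d s IH] k l lm kl ks sn; first by exists [::].
rewrite /weight /= !mulf_eq0 !negb_or => /andP[/andP[/edge_neq0 h _] w0].
have dn : d <> n by apply: sn; rewrite inE eqxx.
have sn' : {in s, forall e, e <> n} by move=> e es; apply: sn; rewrite inE es orbT.
have ks' : ~~ odd (k.+1 + size s) by move: ks; rewrite /= addnS.
have inner (q : nat) : (q < 2 * m)%N -> odd q = odd k -> d = at_level k.+1 q.+1 ->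
    exists x, d :: s = index_of_levels k x.
  move=> qm qk e; have [||x ->] := IH k.+1 q.+1 qm _ ks' sn' _.
  - by rewrite /= qk.
  - by rewrite -e.
  - by exists (Ordinal qm :: x); rewrite /= -e.
case: h => h.
  have [lt|ge] := ltnP l (2 * m); first by apply: (inner l) => //; rewrite h; congr at_level; lia.
  (* the next level would be 2 m + 1, reached at an odd time: index n *)
  case: dn; rewrite h /at_level /= kl /n; case: (boolP (odd l)) => /= ?; lia.
case: l lm kl h => [|[|l]] lm kl h.
- case/eqP: w0; rewrite h; have -> : 0%:Z - 1 = - 0.+1%:Z by lia.
  by apply: weight_below => //; rewrite /= kl.
- case: dn; rewrite h /at_level /= kl /n /=; lia.
- apply: (inner l); [lia|by rewrite kl /= negbK|].
  by rewrite h; congr at_level; lia.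
Qed.

Definition index_tuple L (x : L.-tuple 'I_(2 * m)) : L.-tuple int :=
  tcast (etrans (size_index_of_levels 0 x) (size_tuple x)) (in_tuple (index_of_levels 0 x)).

Lemma index_tupleE L (x : L.-tuple 'I_(2 * m)) :
  index_tuple x = index_of_levels 0 x :> seq int.
Proof. by rewrite /index_tuple val_tcast. Qed.

Lemma sum_beta_minus_term nu :
  \sum_(j \in @indices n (2 * nu)) beta_minus_term a A b B n z j =
  path_sum m a A b B z (2 * nu) 0.
Proof.
rewrite -(@sum_index_of_levels (2 * nu) 0 0) //; last by rewrite mul2n odd_double.
have n0 : at_level 0 0%N = n by rewrite /at_level /= mulr0 subr0.
rewrite n0.
transitivity (\sum_(j \in [set index_tuple x | x in [set: (2 * nu).-tuple 'I_(2 * m)]])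
    beta_minus_term a A b B n z j).
  apply/esym/fsbig_widen => [j [x _ <-] i|j [jn jx]].
    by apply: (@index_of_levels_mem 0 x); rewrite -index_tupleE mem_tnth.
  apply/eqP; apply: contrapT => /negP w0; apply: jx.
  move: w0; rewrite beta_minus_termE => w0.
  have [|||||x jE] := @weight_support 0 0 j; rewrite ?n0 //.
  - by rewrite size_tuple mul2n odd_double.
  - by move=> d /tnthP[i ->]; case: (jn i).
  have sx : size x == (2 * nu)%N.
    by rewrite -(size_index_of_levels 0) -jE size_tuple.
  by exists (Tuple sx) => //; apply: val_inj; rewrite /= index_tupleE.
rewrite fsbig_image; last first.
  move=> x y _ _ /(congr1 val) /=; rewrite !index_tupleE.
  by move=> /index_of_levels_inj; exact: val_inj.
have -> : [set: (2 * nu).-tuple 'I_(2 * m)]%classic =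
    [set` index_enum ((2 * nu).-tuple 'I_(2 * m))]%classic.
  by apply/seteqP; split => x //= _; exact: mem_index_enum.
rewrite -fsbig_seq ?index_enum_uniq //; apply: eq_bigr => x _.
by rewrite beta_minus_termE index_tupleE.
Qed.

End Levels.

(** * The entry of the resolvent *)

Section BetaMinus.
Context {R : realType}.
Local Notation C := R[i].

Lemma limn_eq (u : nat -> C) (l : C) (M : R) :
  (forall N, cabs (l - u N) <= M / 2 ^+ N) -> limn (fun N => u N : C^o) = l.
Proof.
move=> h; apply: cvg_lim; first exact: norm_hausdorff.
apply/cvgrPdist_le => e e0.
have eE : e = (complex.Re e)%:C by rewrite RRe_real ?gtr0_real.
have re0 : 0 < complex.Re e by rewrite -(@ltcR R) -eE.
have M0 : 0 <= M by have := h 0%N; rewrite expr0 divr1; apply: le_trans; exact: cabs_ge0.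
near=> N.
rewrite normE [leRHS]eE lecR; apply: le_trans (h N) _.
rewrite ler_pdivrMr ?exprn_gt0 // -ler_pdivrMl //.
apply: le_trans (_ : N%:R <= _); last first.
  by rewrite -natrX ler_nat ltnW // ltn_expl.
near: N; exact: nbhs_infty_ger.
Unshelve. all: by end_near.
Qed.

Variables (m : nat) (a A b B z : C).
Hypothesis m0 : (0 < m)%N.
Let n : int := (2 * m + 1)%N%:Z.

Lemma beta_minus_continuant (c : R) :
  cabs a <= c -> cabs A <= c -> cabs b <= c -> cabs B <= c -> cabs z <= 1 ->
  2 * c ^+ 2 <= m.-1%:R -> continuant m a A b B z (2 * m) != 0 ->
  beta_minus a A b B n z = a ^+ m.+1 * b ^+ m / continuant m a A b B z (2 * m).
Proof.
move=> ha hA hb hB hz hc K0.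
have [M hM] := path_sum_converges m0 ha hA hb hB hz hc K0.
rewrite /beta_minus.
have -> : coef2 a A (- (2 * n)) = 0.
  by rewrite /coef2 /n; do 2 (case: ifP => [/eqP|_]; first lia).
rewrite add0r.
have odd_terms N : \sum_(1 <= nu < N)
    \sum_(j \in @indices n (2 * nu)) beta_minus_term a A b B n z j =
    \sum_(L < 2 * N) path_sum m a A b B z L 0.
  rewrite (sum_double (fun L => path_sum m a A b B z L 0)).
  (* paths through an odd number of levels do not exist, by parity *)
  have odd0 i : path_sum m a A b B z (2 * i).+1 0 = 0.
    by rewrite path_sum_parity //= mul2n odd_double.
  under [RHS]eq_bigr => i _ do rewrite odd0 addr0.
  case: N => [|N]; first by rewrite big_geq // big_ord0.
  rewrite big_ord_recl big_add1 big_mkord.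
  have -> : path_sum m a A b B z (2 * @ord0 N) 0 = 0.
    by rewrite /path_sum /= /exit_weight ifF //; lia.
  by rewrite add0r; apply: eq_bigr => i _; exact: sum_beta_minus_term.
under eq_fun do rewrite odd_terms.
apply: (@limn_eq _ _ M) => N; apply: le_trans (hM N).
rewrite le_eqVlt; apply/orP; left; apply/eqP; congr (cabs (_ - _)).
by rewrite prod_down exprMn exprS !mulrA.
Qed.

End BetaMinus.

Section Reflection.
Context {R : realType}.
Local Notation C := R[i].

Lemma coef2N (c d : C) k : coef2 c d (- k) = coef2 d c k.
Proof.
by rewrite /coef2; do ?[case: ifP => /eqP ?] => //; lia.
Qed.

Variables (a A b B z : C) (n : int).

(** Each denominator changes sign, and in beta_n^- there is an even number of
    them. *)
Lemma walk_weightN k c s :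
  walk_weight a A b B z (- n) k (- c) (map -%R s) =
  (-1) ^+ size s * walk_weight A a B b (- z) n k c s.
Proof.
have edgeN i d e : edge a A b B i (- d) (- e) = edge A a B b i d e.
  have h : - - d - - e = - (- d - e) by lia.
  by rewrite /edge h -opprD !coef2N.
elim: s k c => [|d s IH] k c /=; first by rewrite edgeN mul1r.
have -> : (- n - - d)%:~R + z = - ((n - d)%:~R + - z) :> C.
  by rewrite !rmorphB !rmorphN /=; ring.
by rewrite edgeN IH invrN exprS; ring.
Qed.

Lemma beta_minusN :
  beta_minus a A b B (- n) z = beta_minus A a B b n (- z).
Proof.
rewrite /beta_minus mulrN coef2N; congr (_ + _).
suff h nu : \sum_(j \in @indices (- n) (2 * nu))
      beta_minus_term a A b B (- n) z j =
    \sum_(j \in @indices n (2 * nu)) beta_minus_term A a B b n (- z) j.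
  by under eq_fun => N do under eq_bigr => nu _ do rewrite h.
have mod2N (x y : int) : (x = y %[mod 2])%Z -> (- x = - y %[mod 2])%Z by lia.
rewrite (@reindex_fsbig _ _ _ _ _ (map_tuple -%R) (@indices n (2 * nu))).
  apply: eq_fsbigr => j _; rewrite !beta_minus_termE /= walk_weightN.
  by rewrite [size _]size_tuple exprM sqrrN !expr1n mul1r.
split.
- move=> j jn i; rewrite tnth_map; have [h1 h2] := jn i.
  by split; [move=> /oppr_inj|exact: mod2N].
- move=> j k _ _ /(congr1 val) /= /inj_map e; apply: val_inj; apply: e.
  exact: oppr_inj.
- move=> j jn; exists (map_tuple -%R j).
    move=> i; rewrite tnth_map; have [h1 h2] := jn i.
    split; [by move=> e; apply: h1; rewrite -e opprK|].
    by rewrite -[n]opprK; exact: mod2N.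
  by apply: eq_from_tnth => i; rewrite !tnth_map opprK.
Qed.

End Reflection.

(** * The walk without backward steps *)

Section SigmaZero.
Context {R : realType}.
Local Notation C := R[i].
Variables (a A b B : C) (m : nat).

Let vertex_nseq (n t : int) N k : (k <= N)%N ->
  vertex n (nseq N t) k = n + k%:Z * t.
Proof.
move=> kN; rewrite /vertex take_nseq // big_nseq -/(iter _ _ _) iter_addr_0.
by rewrite -mulr_natl natz.
Qed.

(** For n > 0 a backward step is a positive one, for n < 0 a negative one, so
    all steps equal t. *)
Lemma walks0 (n t : int) : n = (2 * m + 1)%N%:Z /\ t = -2 \/
    n = - (2 * m + 1)%N%:Z /\ t = 2 ->
  walks n 0 = [set nseq (2 * m + 1) t]%classic.
Proof.
move=> nt; apply/seteqP; split => [y [[_ ys sy _] cy]|_ ->].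
  have yt : y = nseq (size y) t.
    apply/all_pred1P/allP => s sy'; apply/eqP.
    have s0 : ~~ (if 0 < n then 0 < s else s < 0).
      by move/eqP: cy; rewrite -leqn0 leqNgt -has_count => /hasPn; apply.
    by move: s0; case: (ys s sy') nt => -> [[-> ->]|[-> ->]] //=; case: ifP; lia.
  move: sy; rewrite {1}yt big_nseq -/(iter _ _ _) iter_addr_0.
  rewrite -mulr_natl natz => e; rewrite yt; congr nseq.
  by case: nt e => [[-> ->]|[-> ->]]; lia.
split; last first.
  apply/eqP; rewrite -leqn0 leqNgt -has_count; apply/hasPn => s.
  by rewrite mem_nseq => /andP[_ /eqP ->]; case: nt => [[-> ->]|[-> ->]]; case: ifP; lia.
split.
- by rewrite size_nseq addn1 /= mul2n odd_double.
- by move=> s; rewrite mem_nseq => /andP[_ /eqP ->]; case: nt => [[_ ->]|[_ ->]]; [right|left].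
- rewrite big_nseq -/(iter _ _ _) iter_addr_0 -mulr_natl natz.
  by case: nt => [[-> ->]|[-> ->]]; lia.
- rewrite size_nseq => k km; rewrite vertex_nseq; last lia.
  by case: nt => [[-> ->]|[-> ->]]; case: ifP => ok; lia.
Qed.

Lemma sigma_minus0 (n t : int) : n = (2 * m + 1)%N%:Z /\ t = -2 \/
    n = - (2 * m + 1)%N%:Z /\ t = 2 ->
  sigma_minus a A b B 0 n 0 =
  coef2 a A t ^+ m.+1 * coef2 b B t ^+ m / (4 ^+ (2 * m) * m`!%:R ^+ 2).
Proof.
move=> nt; rewrite /sigma_minus (walks0 nt) fsbig_set1 /h_minus size_nseq.
congr (_ / _).
  rewrite big_mkord addn1 big_ord_recr /=.
  have e (i : 'I_(2 * m)) : true -> (if odd i then coef2 b B (nseq (2 * m).+1 t)`_i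
     else coef2 a A (nseq (2 * m).+1 t)`_i) = if odd i then coef2 b B t else coef2 a A t.
    by move=> _; rewrite nth_nseq ltnS ltnW.
  rewrite (eq_bigr _ e) (prod_double (fun i => if odd i then coef2 b B t else coef2 a A t)).
  under eq_bigr => i _ do rewrite /= mul2n odd_double /=.
  rewrite -[t :: nseq (2 * m) t]/(nseq (2 * m).+1 t) !nth_nseq ltnSn.
  rewrite big_const_ord iter_mulr_1 mul2n odd_double exprMn exprS.
  ring.
rewrite addn1 big_add1 /= big_mkord -prod_level_den.
have e (i : 'I_(2 * m)) : true -> 
   (if odd i.+1 then n + vertex n (nseq (2 * m).+1 t) i.+1
    else n - vertex n (nseq (2 * m).+1 t) i.+1)%:~R + 0 =
   (if 0 < n then 1 else -1) * (level_den m i.+1)%:R :> C.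
  move=> _; rewrite addr0 vertex_nseq /level_den; last by have := ltn_ord i; lia.
  have im := ltn_ord i.
  have -> : (if 0 < n then 1 else -1) = (if 0 < n then 1 else -1 : int)%:~R :> C.
    by case: ifP.
  rewrite [X in _ = _ * X]pmulrn -intrM; congr (_%:~R).
  by case: nt => [[-> ->]|[-> ->]]; do ?[case: ifP => ?]; lia.
rewrite (eq_bigr _ e) big_split /= big_const_ord iter_mulr_1.
by case: ifP => _; rewrite ?expr1n ?mul1r // exprM sqrrN !expr1n mul1r.
Qed.

Lemma sigma_minus0_pos : sigma_minus a A b B 0 (2 * m + 1)%N%:Z 0 =
  a ^+ m.+1 * b ^+ m / (4 ^+ (2 * m) * m`!%:R ^+ 2).
Proof. by rewrite (@sigma_minus0 _ (-2)) //; left. Qed.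

Lemma sigma_minus0_neg : sigma_minus a A b B 0 (- (2 * m + 1)%N%:Z) 0 =
  A ^+ m.+1 * B ^+ m / (4 ^+ (2 * m) * m`!%:R ^+ 2).
Proof. by rewrite (@sigma_minus0 _ 2) //; right. Qed.

End SigmaZero.

(** * Asymptotics of the matrix entry *)

Section Asymptotics.
Context {R : realType}.
Local Notation C := R[i].

(** From ln m = 2 ln (sqrt m) <= 2 sqrt m. *)
Lemma ln_le_small (c : R) : 0 <= c -> exists M : nat, forall m : nat,
  (M <= m)%N -> c * (ln m%:R / m%:R) <= 2^-1.
Proof.
move=> c0; exists (Num.bound (16 * c ^+ 2)).+1 => m Mm.
have m0 : 0 < m%:R :> R by rewrite ltr0n; lia.
set s := Num.sqrt (m%:R : R).
have s0 : 0 < s by rewrite sqrtr_gt0.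
have ss : s * s = m%:R by rewrite -expr2 sqr_sqrtr // ltW.
have lns : ln (m%:R : R) <= 2 * s.
  rewrite -ss lnM ?posrE //.
  have := @le_ln1Dx R (s - 1); rewrite [1 + _]addrC subrK ltrBrDl subrr => /(_ s0).
  lra.
have s4c : 4 * c <= s.
  have big : 16 * c ^+ 2 < s * s.
    rewrite ss; apply: lt_le_trans (archi_boundP _) _.
      by rewrite mulr_ge0 ?sqr_ge0.
    by rewrite ler_nat ltnW.
  rewrite leNgt; apply/negP => /ltW lt_s.
  have := ler_pM (ltW s0) (ltW s0) lt_s lt_s.
  by move: big; rewrite expr2; lra.
rewrite mulrA ler_pdivrMr //.
have h1 : c * ln m%:R <= c * (2 * s) by rewrite ler_wpM2l.
have h2 : 4 * c * s <= s * s by apply: ler_wpM2r => //; exact: ltW.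
lra.
Qed.

Section Positive.
Variables (a A b B : C).
Let P : R := cabs (a * B) + cabs (A * b).

Let sigma0 (m : nat) : C := a ^+ m.+1 * b ^+ m / (4 ^+ (2 * m) * m`!%:R ^+ 2).

Let P0 : 0 <= P. Proof. by rewrite addr_ge0 ?cabs_ge0. Qed.

Let beta_ratio (m : nat) (z : C) (c : R) : (0 < m)%N ->
  cabs a <= c -> cabs A <= c -> cabs b <= c -> cabs B <= c -> cabs z <= 1 ->
  2 * c ^+ 2 <= m.-1%:R ->
  cabs (normalized_continuant m a A b B z (2 * m) - 1) <= 2^-1 ->
  exists eps, beta_minus a A b B (2 * m + 1)%N%:Z z = sigma0 m * (1 + eps) /\
    cabs eps <= 2 * cabs (normalized_continuant m a A b B z (2 * m) - 1).
Proof.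
move=> m0 ha hA hb hB hz hc.
rewrite /normalized_continuant prod_level_den.
set K := continuant _ _ _ _ _ _ _; set Q := (X in K / X) => hF.
have Q0 : Q != 0.
  by rewrite mulf_neq0 ?expf_neq0 ?pnatr_eq0 // -lt0n fact_gt0.
have F2 : 2^-1 <= cabs (K / Q).
  have := cabsD (- (K / Q - 1)) (K / Q); rewrite cabsN opprB subrK cabs1.
  by move: hF; lra.
have K0 : K != 0.
  by apply: contraTneq F2 => ->; rewrite mul0r cabs0 -ltNge.
exists ((K / Q)^-1 - 1); split.
  rewrite (beta_minus_continuant m0 ha hA hb hB hz hc K0) /sigma0 -/Q -/K.
  by field; rewrite K0 Q0.
have -> : (K / Q)^-1 - 1 = - (K / Q - 1) / (K / Q) by field; rewrite K0 Q0.
rewrite cabsM cabsN cabsV mulrC; apply: ler_wpM2r; first exact: cabs_ge0.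
by rewrite -[leRHS]invrK lef_pV2 ?posrE // (lt_le_trans _ F2).
Qed.

Let c0 : R := cabs a + cabs A + cabs b + cabs B.

Let le_c0 : [/\ cabs a <= c0, cabs A <= c0, cabs b <= c0 & cabs B <= c0].
Proof.
have := cabs_ge0 a; have := cabs_ge0 A; have := cabs_ge0 b; have := cabs_ge0 B.
rewrite /c0; move: (cabs a) (cabs A) (cabs b) (cabs B) => p q r s *.
by split; lra.
Qed.

Let large_m (kappa : R) : 0 <= kappa -> exists M : nat, forall m : nat,
  (M <= m)%N -> [/\ (4 <= m)%N, 2 * c0 ^+ 2 <= m.-1%:R,
    kappa <= m%:R & (2 * kappa + P) * (ln m%:R / m%:R) <= 2^-1].
Proof.
move=> k0; have [M hM] : exists M : nat, forall m : nat,
    (M <= m)%N -> (2 * kappa + P) * (ln m%:R / m%:R) <= 2^-1.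
  by apply: ln_le_small; rewrite addr_ge0 ?mulr_ge0.
exists (M + 4 + Num.bound (2 * c0 ^+ 2) + Num.bound kappa).+1 => m mM; split.
- by lia.
- apply: le_trans (ltW (archi_boundP _)) _; first by rewrite mulr_ge0 ?sqr_ge0.
  by rewrite ler_nat; lia.
- apply: le_trans (ltW (archi_boundP _)) _ => //.
  by rewrite ler_nat; lia.
- by apply: hM; lia.
Qed.

Let size_le (m : nat) (z : C) (kappa : R) : (4 <= m)%N ->
  cabs z <= kappa / m%:R ->
  harmonic_sum m * (cabs z / 2 + P / (8 * m%:R)) <=
  (kappa + P / 4) * (ln m%:R / m%:R).
Proof.
move=> m4 zk; have m0 : 0 < m%:R :> R by rewrite ltr0n; lia.
have -> : (kappa + P / 4) * (ln m%:R / m%:R) =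
   2 * ln m%:R * (kappa / m%:R / 2 + P / (8 * m%:R)) by field; rewrite gt_eqF.
apply: ler_pM; rewrite ?harmonic_sum_ge0 ?harmonic_sum_le_ln //.
  by rewrite addr_ge0 ?divr_ge0 ?cabs_ge0 ?mulr_ge0 // ltW.
by rewrite lerD2r; lra.
Qed.

Lemma beta_minus_leading (kappa : R) : 0 <= kappa ->
  exists (c : R) (M : nat), forall m : nat, (M <= m)%N ->
  forall z : C, cabs z <= kappa / m%:R ->
  exists eps, beta_minus a A b B (2 * m + 1)%N%:Z z = sigma0 m * (1 + eps) /\
    cabs eps <= c * (ln m%:R / m%:R).
Proof.
move=> k0; have [M hM] := large_m k0.
exists (4 * (kappa + P / 4)), M => m /hM[m4 mc mk small] z hz.
have m00 : (0 < m)%N by exact: leq_trans m4.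
have [aC AC bC BC] := le_c0.
have m0 : 0 < m%:R :> R by rewrite ltr0n.
have z1 : cabs z <= 1 by apply: le_trans hz _; rewrite ler_pdivrMr ?mul1r.
have hS := size_le m4 hz.
have ln0 : 0 <= ln m%:R / m%:R :> R by rewrite divr_ge0 ?ltW // (lt_le_trans _ (ln_ge1 m4)).
have q0 : 0 <= P * (ln m%:R / m%:R) by rewrite mulr_ge0.
have hF : cabs (normalized_continuant m a A b B z (2 * m) - 1) <=
    2 * ((kappa + P / 4) * (ln m%:R / m%:R)).
  apply: le_trans (continuant_near1 m00 _) _.
    by apply: le_trans hS _; lra.
  by rewrite ler_wpM2l.
have [|eps [e1 e2]] := @beta_ratio m z c0 m00 aC AC bC BC z1 mc.
  by apply: le_trans hF _; lra.
by exists eps; split=> //; apply: le_trans e2 _; lra.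
Qed.

(** At the distance E / m^2 from (A b + a B) / (4m) the harmonic first order
    terms cancel up to O(log m / m^2), and the quadratic error remains. *)
Lemma beta_minus_second (E : R) : 0 <= E ->
  exists (c : R) (M : nat), forall m : nat, (M <= m)%N ->
  forall z : C, cabs (z - (A * b + a * B) / (4 * m%:R)) <= E / m%:R ^+ 2 ->
  exists eps, beta_minus a A b B (2 * m + 1)%N%:Z z = sigma0 m * (1 + eps) /\
    cabs eps <= c * (ln m%:R ^+ 2 / m%:R ^+ 2).
Proof.
move=> E0; pose kappa := E + P / 4.
have k0 : 0 <= kappa by rewrite addr_ge0 ?divr_ge0.
have [M hM] := large_m k0.
exists (2 * (E + P / 4 + 2 * (kappa + P / 4) ^+ 2)), M => m /hM[m4 mc mk small] z hzE.
have m00 : (0 < m)%N by exact: leq_trans m4.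
have [aC AC bC BC] := le_c0.
have m0 : 0 < m%:R :> R by rewrite ltr0n.
have m1 : 1 <= m%:R :> R by rewrite ler1n.
have hz : cabs z <= kappa / m%:R.
  have := cabsD (z - (A * b + a * B) / (4 * m%:R)) ((A * b + a * B) / (4 * m%:R)).
  rewrite subrK => h; apply: le_trans h _.
  rewrite /kappa [leRHS]mulrDl; apply: lerD.
    apply: le_trans hzE _; rewrite ler_wpM2l // lef_pV2 ?posrE ?exprn_gt0 //.
    by rewrite expr2 ler_peMl // ltW.
  rewrite cabsM cabsV cabsM !cabs_nat invfM mulrA ler_pM2r ?invr_gt0 //.
  by rewrite ler_pM2r // /P addrC; exact: cabsD.
have z1 : cabs z <= 1 by apply: le_trans hz _; rewrite ler_pdivrMr ?mul1r.
have hS := size_le m4 hz.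
have ln1 := @ln_ge1 R _ m4.
have ln0 : 0 <= ln m%:R / m%:R :> R by rewrite divr_ge0 ?ltW // (lt_le_trans _ ln1).
have q0 : 0 <= P * (ln m%:R / m%:R) by rewrite mulr_ge0.
have S0 : 0 <= harmonic_sum m * (cabs z / 2 + P / (8 * m%:R)).
  by rewrite mulr_ge0 ?harmonic_sum_ge0 // addr_ge0 ?divr_ge0 ?cabs_ge0 ?mulr_ge0 // ltW.
have hS2 : harmonic_sum m * (cabs z / 2 + P / (8 * m%:R)) <= 2^-1.
  by apply: le_trans hS _; rewrite /kappa in small *; lra.
have near1 := @continuant_near1 R m a A b B z m00 hS2.
have hF := @continuant_first_order R m a A b B z m00 hS2.
rewrite -/P in near1 hF.
have [|eps [e1 e2]] := @beta_ratio m z c0 m00 aC AC bC BC z1 mc.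
  apply: le_trans near1 _.
  have : 2 * ((kappa + P / 4) * (ln m%:R / m%:R)) <= 2^-1.
    move: small; rewrite /kappa; lra.
  by move: hS; lra.
exists eps; split=> //; apply: le_trans e2 _.
rewrite -[leRHS]mulrA ler_pM2l //; apply: le_trans hF _.
have l2 : 0 <= ln m%:R ^+ 2 / m%:R ^+ 2 :> R by rewrite divr_ge0 ?sqr_ge0.
have H2 : harmonic_sum m / m%:R ^+ 2 <= 2 * (ln m%:R ^+ 2 / m%:R ^+ 2) :> R.
  rewrite [leRHS]mulrA ler_pM2r ?invr_gt0 ?exprn_gt0 //.
  apply: le_trans (harmonic_sum_le_ln m4) _.
  by rewrite ler_pM2l // expr2 ler_peMl // (le_trans _ ln1).
rewrite [leRHS]mulrDl [X in _ <= X + _]mulrDl; apply: lerD; first apply: lerD.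
- apply: le_trans (_ : harmonic_sum m / 2 * (E / m%:R ^+ 2) <= _).
    by rewrite ler_wpM2l ?divr_ge0 ?harmonic_sum_ge0.
  have -> : harmonic_sum m / 2 * (E / m%:R ^+ 2) =
     E / 2 * (harmonic_sum m / m%:R ^+ 2) by ring.
  have -> : E * (ln m%:R ^+ 2 / m%:R ^+ 2) =
    E / 2 * (2 * (ln m%:R ^+ 2 / m%:R ^+ 2)) by field; rewrite gt_eqF.
  by rewrite ler_wpM2l ?divr_ge0.
- have -> : P * harmonic_sum m / (8 * m%:R ^+ 2) =
     P / 8 * (harmonic_sum m / m%:R ^+ 2) by field; rewrite gt_eqF.
  have -> : P / 4 * (ln m%:R ^+ 2 / m%:R ^+ 2) =
    P / 8 * (2 * (ln m%:R ^+ 2 / m%:R ^+ 2)) by field; rewrite gt_eqF.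
  by rewrite ler_wpM2l ?divr_ge0.
- rewrite -mulrA ler_pM2l //.
  rewrite -expr_div_n -exprMn.
  by rewrite ler_pXn2r ?nnegrE // (le_trans S0).
Qed.

End Positive.
End Asymptotics.

(** * The Fourier system of an eigenfunction *)

Ltac int_lia := match goal with R : realType |- _ => clear dependent R end; lia.

Section FourierSystem.
Context {R : realType}.
Local Notation C := R[i].

(** Relations between the Fourier coefficients u of y_1 and v of y_2 for a
    solution of L y = (n + z) y. *)
Definition fourier_system (a A b B : C) (n : int) (z : C) (u v : int -> C) :=
  forall k : int, (k = n %[mod 2])%Z ->
    ((n + k)%:~R + z) * u k = a * v (k + 2) + A * v (k - 2) /\
    ((n - k)%:~R + z) * v k = b * u (k + 2) + B * u (k - 2).

(** The symmetry exchanging the two resonant coefficients u_(-n) and v_n. *)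
Lemma fourier_systemN a A b B n z u v : fourier_system a A b B n z u v ->
  fourier_system B b A a n z (fun k => v (- k)) (fun k => u (- k)).
Proof.
move=> h k kn; have [|h1 h2] := h (- k); first by lia.
have e1 : - (k + 2) = - k - 2 by lia.
have e2 : - (k - 2) = - k + 2 by lia.
rewrite opprK in h2; rewrite e1 e2; split; first by rewrite h2 addrC.
by rewrite h1 addrC.
Qed.

Section Estimates.
Variables (a A b B z : C) (n : int) (u v : int -> C) (c : R).
Hypothesis sys : fourier_system a A b B n z u v.
Hypothesis aC : cabs a <= c.
Hypothesis AC : cabs A <= c.
Hypothesis bC : cabs b <= c.
Hypothesis BC : cabs B <= c.
Hypothesis c1 : 1 <= c.
Hypothesis z1 : cabs z <= 2^-1.
Let N : R := `|n|%:~R.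
Hypothesis N7 : 7 <= N.
Hypothesis Nc : 8 * c ^+ 2 <= N.

Let den_ge (k : int) : `|k|%:~R - 2^-1 <= cabs (k%:~R + z).
Proof. have := cabs_sub_ge k%:~R z; rewrite cabs_int; move: z1; lra. Qed.

Let lin_le (p q x y : C) (X : R) : cabs p <= c -> cabs q <= c ->
  cabs x <= X -> cabs y <= X -> cabs (p * x + q * y) <= 2 * c * X.
Proof.
move=> hp hq hx hy; apply: le_trans (cabsD _ _) _; rewrite !cabsM.
have h1 : cabs p * cabs x <= c * X by rewrite ler_pM ?cabs_ge0.
have h2 : cabs q * cabs y <= c * X by rewrite ler_pM ?cabs_ge0.
lra.
Qed.

Let u_le k (X : R) : (k = n %[mod 2])%Z -> cabs (v (k + 2)) <= X -> cabs (v (k - 2)) <= X ->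
  cabs ((n + k)%:~R + z) * cabs (u k) <= 2 * c * X.
Proof. by move=> kn h1 h2; rewrite -cabsM (sys kn).1; exact: lin_le. Qed.

Let v_le k (X : R) : (k = n %[mod 2])%Z -> cabs (u (k + 2)) <= X -> cabs (u (k - 2)) <= X ->
  cabs ((n - k)%:~R + z) * cabs (v k) <= 2 * c * X.
Proof. by move=> kn h1 h2; rewrite -cabsM (sys kn).2; exact: lin_le. Qed.

(** In two consecutive steps of the system the integer parts x = n + k and
    y = n - (k + 2) or n - (k - 2) of the denominators add up to about 2n, so
    only one of them can be small. *)
Lemma den_product (x y : int) : 2 <= `|x| -> 2 <= `|y| ->
  2 * `|n| - 2 <= `|x| + `|y| ->
  N <= cabs (x%:~R + z) * cabs (y%:~R + z).
Proof.
move=> x2 y2 xy; have hx := den_ge x; have hy := den_ge y.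
have X2 : 2 <= `|x|%:~R :> R by rewrite (ler_int R 2).
have Y2 : 2 <= `|y|%:~R :> R by rewrite (ler_int R 2).
have XY : 2 * N - 2 <= `|x|%:~R + `|y|%:~R.
  by move: xy; rewrite -(ler_int R) rmorphB rmorphM [X in _ <= X -> _]intrD; exact: id.
apply: le_trans (_ : (`|x|%:~R - 2^-1) * (`|y|%:~R - 2^-1) <= _); last first.
  by apply: ler_pM => //; lra.
have : 0 <= (`|x|%:~R - 2) * (`|y|%:~R - 2) :> R by rewrite mulr_ge0; lra.
move: N7; lra.
Qed.

Let two_steps (D D' X y : R) : 1 <= D -> 0 <= D' -> N <= D * D' -> 0 <= X ->
  D' * y <= 2 * c * X -> 0 <= y -> y <= D * (X / (4 * c)).
Proof.
move=> D1 D0 DD X0 h y0; rewrite mulrA ler_pdivlMr; last by move: c1; lra.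
have D'0 : 0 < D'.
  rewrite lt0r D0 andbT; apply/eqP => e; move: DD N7; rewrite e mulr0; lra.
rewrite -(ler_pM2l D'0).
have h1 : N * X <= D * D' * X by rewrite ler_wpM2r.
have h2 : 8 * c ^+ 2 * X <= N * X by rewrite ler_wpM2r.
have h3 : D' * y * (4 * c) <= 2 * c * X * (4 * c).
  by rewrite ler_wpM2r //; move: c1; lra.
have -> : D' * (y * (4 * c)) = D' * y * (4 * c) by ring.
apply: le_trans h3 _.
have -> : 2 * c * X * (4 * c) = 8 * c ^+ 2 * X by ring.
have -> : D' * (D * X) = D * D' * X by ring.
exact: le_trans h2 h1.
Qed.

Let s : R := Num.max (cabs (u (- n))) (cabs (v n)).

Let s0 : 0 <= s.
Proof. by rewrite /s le_max cabs_ge0. Qed.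

Let improve (X : R) : (forall k, (k = n %[mod 2])%Z -> cabs (u k) <= X /\ cabs (v k) <= X) ->
  forall k, (k = n %[mod 2])%Z ->
    cabs (u k) <= 2 * c * s + X / 2 /\ cabs (v k) <= 2 * c * s + X / 2.
Proof.
move=> hX k kn.
have X0 : 0 <= X by apply: le_trans (hX k kn).1; exact: cabs_ge0.
have cs : s <= 2 * c * s by rewrite ler_peMl //; move: c1; lra.
have X2 : 0 <= X / 2 by rewrite divr_ge0.
have small (D y : R) : 1 <= D -> 0 <= y -> y <= s -> y <= D * s + D * (X / (4 * c)).
  move=> D1 y0 ys; have : s <= D * s by rewrite ler_peMl.
  have : 0 <= D * (X / (4 * c)) by rewrite mulr_ge0 ?divr_ge0 //; move: c1; lra.
  lra.
have conclude (D y : R) : 1 <= D -> D * y <= 2 * c * (D * s + D * (X / (4 * c))) ->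
    y <= 2 * c * s + X / 2.
  move=> D1 h; have D0 : 0 < D by lra.
  rewrite -(ler_pM2l D0); apply: le_trans h _.
  rewrite le_eqVlt; apply/orP; left; apply/eqP; field.
  by rewrite gt_eqF //; move: c1; lra.
have den1 (x : int) : 2 <= `|x| -> 1 <= cabs (x%:~R + z).
  move=> x2; have := den_ge x; have : 2 <= `|x|%:~R :> R by rewrite (ler_int R 2).
  lra.
split.
- have [->|kne] := eqVneq k (- n).
    by apply: le_trans (_ : s <= _); [rewrite /s le_max lexx|lra].
  have D1 : 1 <= cabs ((n + k)%:~R + z) by apply: den1; int_lia.
  have vb l : (l = n %[mod 2])%Z -> `|l - k| = 2 ->
      cabs (v l) <= cabs ((n + k)%:~R + z) * s + cabs ((n + k)%:~R + z) * (X / (4 * c)).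
    move=> ln lk; have [->|lne] := eqVneq l n.
      by apply: small => //; rewrite ?cabs_ge0 // /s le_max lexx orbT.
    apply: le_trans (_ : cabs ((n + k)%:~R + z) * (X / (4 * c)) <= _); last first.
      by rewrite lerDr mulr_ge0 // cabs_ge0.
    apply: (two_steps (D' := cabs ((n - l)%:~R + z))); rewrite ?cabs_ge0 //.
      by apply: den_product; int_lia.
    by apply: v_le => //; [apply: (hX _ _).1|apply: (hX _ _).1]; int_lia.
  apply: conclude D1 _; apply: u_le => //; apply: vb; int_lia.
- have [->|kne] := eqVneq k n.
    by apply: le_trans (_ : s <= _); [rewrite /s le_max lexx orbT|lra].
  have D1 : 1 <= cabs ((n - k)%:~R + z) by apply: den1; int_lia.
  have ub l : (l = n %[mod 2])%Z -> `|l - k| = 2 ->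
      cabs (u l) <= cabs ((n - k)%:~R + z) * s + cabs ((n - k)%:~R + z) * (X / (4 * c)).
    move=> ln lk; have [->|lne] := eqVneq l (- n).
      by apply: small => //; rewrite ?cabs_ge0 // /s le_max lexx.
    apply: le_trans (_ : cabs ((n - k)%:~R + z) * (X / (4 * c)) <= _); last first.
      by rewrite lerDr mulr_ge0 // cabs_ge0.
    apply: (two_steps (D' := cabs ((n + l)%:~R + z))); rewrite ?cabs_ge0 //.
      by apply: den_product; int_lia.
    by apply: u_le => //; [apply: (hX _ _).2|apply: (hX _ _).2]; int_lia.
  apply: conclude D1 _; apply: v_le => //; apply: ub; int_lia.
Qed.

(** Two steps of the system away from the resonant coefficients gain a factor
    1 / |n|, so the supremum W of all coefficients satisfies
    W <= 2 c s + W / 2. *)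
Lemma resonant_control M :
  (forall k, cabs (u k) <= M /\ cabs (v k) <= M) ->
  forall k, (k = n %[mod 2])%Z ->
    cabs (u k) <= 4 * c * s /\ cabs (v k) <= 4 * c * s.
Proof.
move=> hM.
pose S := [set x : R | exists2 k, (k = n %[mod 2])%Z &
   x = cabs (u k) \/ x = cabs (v k)]%classic.
have ubS : has_ubound S.
  by exists M => x [k _ [->|->]]; case: (hM k).
have S_n0 : (S !=set0)%classic by exists (cabs (u n)), n => //; left.
have hsup k : (k = n %[mod 2])%Z -> cabs (u k) <= sup S /\ cabs (v k) <= sup S.
  by move=> kn; split; apply: ub_le_sup => //; exists k => //; [left|right].
have : sup S <= 2 * c * s + sup S / 2.
  apply: ge_sup => // x [k kn [->|->]]; by case: (improve hsup kn).
move=> h k /hsup[h1 h2]; split; lra.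
Qed.

(** Expanding the resonant equation two steps; the coefficients next to the
    resonant one have a denominator of order 2n. *)
Lemma resonant_expansion : 0 < cabs (u (- n)) ->
  (forall k, (k = n %[mod 2])%Z ->
    cabs (u k) <= 4 * c * cabs (u (- n)) /\ cabs (v k) <= 4 * c * cabs (u (- n))) ->
  cabs ((2 * n)%:~R * z - (A * b + a * B)) <= 64 * c ^+ 5 / N.
Proof.
set U := u (- n) => U0 hW; set W := 4 * c * cabs U in hW.
have W0 : 0 <= W by rewrite mulr_ge0 ?cabs_ge0 //; move: c1; lra.
have N0 : 0 < N by move: N7; lra.
have v_small l : (l = n %[mod 2])%Z -> `|l + n| <= 6 -> cabs (v l) <= 2 * c * W / N.
  move=> ln l6; rewrite ler_pdivlMr // mulrC.
  apply: le_trans (_ : cabs ((n - l)%:~R + z) * cabs (v l) <= _).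
    apply: ler_wpM2r; first exact: cabs_ge0.
    apply: le_trans (den_ge _).
    have : 2 * N - 6 <= `|n - l|%:~R.
      have : 2 * `|n| - 6 <= `|n - l| by int_lia.
      by rewrite -(ler_int R) rmorphB rmorphM; exact: id.
    move: N7; lra.
  by apply: v_le => //; apply: (hW _ _).1; int_lia.
have u_small l : (l = n %[mod 2])%Z -> `|l + n| = 4 -> cabs (u l) <= 2 * c ^+ 2 * W / N.
  move=> ln l4.
  have h : cabs ((n + l)%:~R + z) * cabs (u l) <= 2 * c * (2 * c * W / N).
    by apply: u_le => //; apply: v_small; int_lia.
  have d2 : 2 <= cabs ((n + l)%:~R + z).
    have := den_ge (n + l); have -> : `|n + l| = 4 by int_lia.
    lra.
  have : 2 * cabs (u l) <= cabs ((n + l)%:~R + z) * cabs (u l).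
    by rewrite ler_wpM2r ?cabs_ge0.
  have -> : 2 * c ^+ 2 * W / N = (2 * c * (2 * c * W / N)) / 2 by field; rewrite gt_eqF.
  lra.
have [|e0 _] := sys (k := - n); first by int_lia.
have [|_ e1] := sys (k := - n + 2); first by int_lia.
have [|_ e2] := sys (k := - n - 2); first by int_lia.
have k1 : - n + 2 + 2 = - n + 4 by int_lia.
have k2 : - n + 2 - 2 = - n by int_lia.
have k3 : - n - 2 + 2 = - n by int_lia.
have k4 : - n - 2 - 2 = - n - 4 by int_lia.
have k5 : n - (- n + 2) = 2 * n - 2 by int_lia.
have k6 : n - (- n - 2) = 2 * n + 2 by int_lia.
rewrite subrr mulr0z add0r in e0.
rewrite k1 k2 k5 rmorphB -/U in e1; rewrite k3 k4 k6 rmorphD -/U in e2.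
have e : ((2 * n)%:~R * z - (A * b + a * B)) * U =
   (a * b * u (- n + 4) + A * B * u (- n - 4)) +
   (a * (2 - z) * v (- n + 2) - A * (2 + z) * v (- n - 2)).
  have -> : ((2 * n)%:~R * z - (A * b + a * B)) * U =
      (2 * n)%:~R * (z * U) - (A * b + a * B) * U by ring.
  rewrite -/U in e0; rewrite e0.
  have -> : (2 * n)%:~R * (a * v (- n + 2) + A * v (- n - 2)) =
    a * (((2 * n)%:~R - 2 + z) * v (- n + 2)) + a * (2 - z) * v (- n + 2) +
    (A * (((2 * n)%:~R + 2 + z) * v (- n - 2)) - A * (2 + z) * v (- n - 2)) by ring.
  rewrite e1 e2; ring.
rewrite -(ler_pM2r U0) -cabsM e.
have z2 (x : C) : cabs x = cabs z -> cabs (2 + x) <= 3.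
  move=> xz; apply: le_trans (cabsD _ _) _; rewrite (cabs_nat 2) xz; move: z1; lra.
have b1 : cabs (a * b * u (- n + 4)) <= c ^+ 2 * (2 * c ^+ 2 * W / N).
  rewrite !cabsM expr2; apply: ler_pM; rewrite ?mulr_ge0 ?cabs_ge0 //.
    by apply: ler_pM; rewrite ?cabs_ge0.
  by rewrite -expr2; apply: u_small; int_lia.
have b2 : cabs (A * B * u (- n - 4)) <= c ^+ 2 * (2 * c ^+ 2 * W / N).
  rewrite !cabsM expr2; apply: ler_pM; rewrite ?mulr_ge0 ?cabs_ge0 //.
    by apply: ler_pM; rewrite ?cabs_ge0.
  by rewrite -expr2; apply: u_small; int_lia.
have b3 : cabs (a * (2 - z) * v (- n + 2)) <= c * 3 * (2 * c * W / N).
  rewrite !cabsM; apply: ler_pM; rewrite ?mulr_ge0 ?cabs_ge0 //.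
    by apply: ler_pM; rewrite ?cabs_ge0 // z2 // cabsN.
  by apply: v_small; int_lia.
have b4 : cabs (A * (2 + z) * v (- n - 2)) <= c * 3 * (2 * c * W / N).
  rewrite !cabsM; apply: ler_pM; rewrite ?mulr_ge0 ?cabs_ge0 //.
    by apply: ler_pM; rewrite ?cabs_ge0 // z2.
  by apply: v_small; int_lia.
apply: le_trans (cabsD _ _) _.
apply: le_trans (lerD (cabsD _ _) (cabsB _ _)) _.
apply: le_trans (lerD (lerD b1 b2) (lerD b3 b4)) _.
have -> : c ^+ 2 * (2 * c ^+ 2 * W / N) + c ^+ 2 * (2 * c ^+ 2 * W / N) +
   (c * 3 * (2 * c * W / N) + c * 3 * (2 * c * W / N)) =
   (16 * c ^+ 5 + 48 * c ^+ 3) * (cabs U / N) by rewrite /W; field; rewrite gt_eqF.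
have -> : 64 * c ^+ 5 / N * cabs U = 64 * c ^+ 5 * (cabs U / N) by ring.
apply: ler_wpM2r; first by rewrite divr_ge0 ?cabs_ge0 // ltW.
have : c ^+ 3 <= c ^+ 5 by rewrite ler_weXn2l.
lra.
Qed.

End Estimates.

(** By symmetry u_(-n) may be taken as the larger resonant coefficient; it is
    not zero since it controls a nonzero coefficient. *)
Lemma fourier_resonance a A b B z n u v (c M : R) :
  fourier_system a A b B n z u v ->
  cabs a <= c -> cabs A <= c -> cabs b <= c -> cabs B <= c -> 1 <= c ->
  cabs z <= 2^-1 -> 7 <= `|n|%:~R :> R -> 8 * c ^+ 2 <= `|n|%:~R ->
  (forall k, cabs (u k) <= M /\ cabs (v k) <= M) ->
  (exists2 k, (k = n %[mod 2])%Z & u k != 0 \/ v k != 0) ->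
  cabs ((2 * n)%:~R * z - (A * b + a * B)) <= 64 * c ^+ 5 / `|n|%:~R.
Proof.
move=> sys aC AC bC BC c1 z1 N7 Nc hM [k0 k0n nz].
have ctrl := resonant_control sys aC AC bC BC c1 z1 N7 Nc hM.
have s_gt0 : 0 < Num.max (cabs (u (- n))) (cabs (v n)).
  rewrite lt_neqAle le_max cabs_ge0 andbT; apply/eqP => e.
  have [] := ctrl k0 k0n; rewrite -e mulr0.
  have le0 (w : C) : cabs w <= 0 -> w = 0.
    by move=> h; apply/eqP; rewrite -cabs_eq0 eq_le h cabs_ge0.
  by move=> /le0 hu /le0 hv; move: nz; rewrite hu hv eqxx; case.
case: (leP (cabs (v n)) (cabs (u (- n)))) => vu;
  rewrite ?(max_l vu) ?(max_r (ltW vu)) in s_gt0 ctrl.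
  exact: (resonant_expansion sys).
have := @resonant_expansion B b A a z n (fun k => v (- k)) (fun k => u (- k)) c.
rewrite opprK => h; rewrite [A * b]mulrC [a * B]mulrC.
apply: h => //; first exact: fourier_systemN.
by move=> k kn; have [|h1 h2] := ctrl (- k); first by int_lia.
Qed.
End FourierSystem.

(** * Integration over [0, pi] *)

Section RealIntegral.
Context {R : realType}.
Local Open Scope classical_set_scope.

Local Notation I := (`[(0 : R), pi]%classic).

Definition rint (f : R -> R) : R := \int[lebesgue_measure]_(x in I) f x.

Definition cont (f : R -> R) : Prop := {within I, continuous f}.

Lemma cont_itv f : cont f -> [/\ {in `]0, pi[%R, continuous f},
  f x @[x --> 0^'+] --> f 0 & f x @[x --> pi^'-] --> f pi].
Proof. by move=> cf; have /continuous_within_itvP := cf => /(_ (pi_gt0 R)). Qed.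

Lemma contD f g : cont f -> cont g -> cont (fun x => f x + g x).
Proof. by move=> cf cg x; apply: cvgD; [exact: cf|exact: cg]. Qed.

Lemma contM f g : cont f -> cont g -> cont (fun x => f x * g x).
Proof. by move=> cf cg x; apply: cvgM; [exact: cf|exact: cg]. Qed.

Lemma contN f : cont f -> cont (fun x => - f x).
Proof. by move=> cf x; apply: cvgN; exact: cf. Qed.

Lemma cont_norm f : cont f -> cont (fun x => `|f x|).
Proof. by move=> cf x; apply: cvg_norm; exact: cf. Qed.

Lemma cont_continuous f : continuous f -> cont f.
Proof. exact: continuous_subspaceT. Qed.

Lemma cont_cst c : cont (fun=> c).
Proof. by apply: cont_continuous => x; exact: cvg_cst. Qed.

Lemma contX f n : cont f -> cont (fun x => f x ^+ n).
Proof.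
move=> cf; elim: n => [|n IH].
  by under eq_fun do rewrite expr0; exact: cont_cst.
by under eq_fun do rewrite exprS; exact: contM.
Qed.

Lemma cont_integrable f : cont f ->
  lebesgue_measure.-integrable I (EFin \o f).
Proof.
move=> cf; apply: continuous_compact_integrable => //; exact: segment_compact.
Qed.

Lemma rintD f g : cont f -> cont g ->
  rint (fun x => f x + g x) = rint f + rint g.
Proof. by move=> cf cg; apply: RintegralD => //; exact: cont_integrable. Qed.

Lemma rintZ c f : cont f -> rint (fun x => c * f x) = c * rint f.
Proof. by move=> cf; apply: RintegralZl => //; exact: cont_integrable. Qed.

Lemma rint_le f g : cont f -> cont g ->
  (forall x, 0 <= x <= pi -> f x <= g x) -> rint f <= rint g.
Proof.
move=> cf cg fg; apply: le_Rintegral; rewrite ?cont_integrable //.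
Qed.

Lemma eq_rint f g : (forall x, 0 <= x <= pi -> f x = g x) -> rint f = rint g.
Proof.
by move=> fg; apply: eq_Rintegral => x; rewrite inE /= in_itv /=; exact: fg.
Qed.

Lemma rint_derive (F f : R -> R) : cont F -> cont f ->
  (forall x : R, 0 < x < pi -> is_derive x 1 F (f x)) ->
  rint f = F pi - F 0.
Proof.
move=> cF cf dF; rewrite /rint /Rintegral.
rewrite (@continuous_FTC2 R f F 0 pi) //; first exact: pi_gt0.
  have [c1 c2 c3] := cont_itv cF.
  by split => // x; rewrite in_itv /= => /dF h; exact: ex_derive.
by move=> x; rewrite in_itv /= => /dF h; rewrite derive1E derive_val.
Qed.

End RealIntegral.

Section Derivatives.
Context {R : realType}.
Implicit Types f g : R -> R.

Lemma derD f g (x df dg : R) : is_derive x 1 f df -> is_derive x 1 g dg ->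
  is_derive x 1 (fun t => f t + g t) (df + dg).
Proof. exact: is_deriveD. Qed.

Lemma derN f (x df : R) : is_derive x 1 f df -> is_derive x 1 (fun t => - f t) (- df).
Proof. exact: is_deriveN. Qed.

Lemma derM f g (x df dg : R) : is_derive x 1 f df -> is_derive x 1 g dg ->
  is_derive x 1 (fun t => f t * g t) (df * g x + f x * dg).
Proof.
move=> hf hg; have h := is_deriveM hf hg.
by apply: (is_derive_eq h); rewrite addrC mulrC.
Qed.

Lemma derX f n (x df : R) : is_derive x 1 f df ->
  is_derive x 1 (fun t => f t ^+ n) (n%:R * f x ^+ n.-1 * df).
Proof.
by move=> hf; have := is_deriveX n hf; rewrite exprfctE.
Qed.

Lemma der_affine (p q x : R) : is_derive x 1 (fun t : R => p * t + q) p.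
Proof.
have h := derD (derM (is_derive_cst p x 1) (is_derive_id x 1)) (is_derive_cst q x 1).
by apply: (is_derive_eq h); rewrite mul0r add0r mulr1 addr0.
Qed.

Lemma der_cos_affine (p q x : R) :
  is_derive x 1 (fun t : R => cos (p * t + q)) (- sin (p * x + q) * p).
Proof. exact: (is_derive1_comp (is_derive_cos _) (der_affine p q x)). Qed.

Lemma der_sin_affine (p q x : R) :
  is_derive x 1 (fun t : R => sin (p * t + q)) (cos (p * x + q) * p).
Proof. exact: (is_derive1_comp (is_derive_sin _) (der_affine p q x)). Qed.

Lemma is_derive_cont f : (forall x : R, exists d : R, is_derive x 1 f d) -> cont f.
Proof.
move=> h; apply: cont_continuous => x; have [d hd] := h x.
by apply/differentiable_continuous/derivable1_diffP; exact: ex_derive.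
Qed.

End Derivatives.

(** * Completeness of the trigonometric system *)

Section Peak.
Context {R : realType}.
Variable x0 : R.

(* an affine argument, as in der_cos_affine *)
Let h (x : R) : R := cos (1 * x + - x0).

Let hpi : h pi = - h 0.
Proof. by rewrite /h mul1r mulr0 add0r addrC cosDpi. Qed.

Let cont_h : cont h.
Proof. by apply: is_derive_cont => x; eexists; exact: der_cos_affine. Qed.

Let J (N : nat) : R := rint (fun x => h x ^+ (2 * N)).

(* integrate the derivative of cos^(2N+1) sin, a function of period pi *)
Let J_rec N : (2 * N + 2)%:R * J N.+1 = (2 * N + 1)%:R * J N.
Proof.
pose F (x : R) := h x ^+ (2 * N).+1 * sin (1 * x + - x0).
have cs : cont (fun x : R => sin (1 * x + - x0)).
  by apply: is_derive_cont => x; eexists; exact: der_sin_affine.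
have cF : cont F by apply: contM => //; exact: contX.
pose f (x : R) := (2 * N + 2)%:R * h x ^+ (2 * N.+1) + - (2 * N + 1)%:R * h x ^+ (2 * N).
have cf : cont f.
  by apply: contD; (apply: contM; [exact: cont_cst|exact: contX]).
have := rint_derive cF cf; have -> : F pi - F 0 = 0.
  rewrite /F hpi mul1r mulr0 add0r [pi + _]addrC sinDpi exprNn -signr_odd /=.
  by rewrite mul2n odd_double /= expr1; ring.
rewrite /f rintD; try by apply: contM; [exact: cont_cst|exact: contX].
rewrite !rintZ; try exact: contX.
move=> e; apply/eqP; rewrite -subr_eq0 -mulNr; apply/eqP; apply: e => x _.
have hd := derM (derX (2 * N).+1 (der_cos_affine 1 (- x0) x)) (der_sin_affine 1 (- x0) x).
apply: (is_derive_eq hd); rewrite -/(h x) /=.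
have -> : (2 * N.+1 = (2 * N).+2)%N by lia.
have s2 := cos2Dsin2 (1 * x + - x0); rewrite -/(h x) in s2.
rewrite addn1 addn2 !mulr1 exprSr -[(2 * N).+2%:R]natr1 !exprSr.
move: (sin _) (h x) (h x ^+ (2 * N)) ((2 * N).+1%:R) s2 => S H HN k s2.
have sE : S * S = 1 - H * H by rewrite -!expr2 -s2; ring.
transitivity (- (k * HN * (S * S)) + HN * H * H); first by ring.
by rewrite sE; ring.
Qed.

Let J_gt0 N : 0 < J N.
Proof.
elim: N => [|N IH].
  have := @rint_derive R id (fun=> 1); rewrite /J muln0.
  under [rint (fun x => h x ^+ 0)]eq_rint do rewrite expr0.
  move=> -> //; rewrite ?subr0 ?pi_gt0 //; last exact: cont_cst.
  by apply: cont_continuous => x; exact: cvg_id.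
have e := J_rec N; rewrite -(ltr_pM2l (_ : 0 < (2 * N + 2)%:R)) ?ltr0n ?addn2 //.
by rewrite mulr0 -[(2 * N).+2]addn2 e mulr_gt0 // ltr0n addn1.
Qed.

(** Against the kernels cos^(2N) (x - x0), which have mass J N peaked at x0, a
    continuous function vanishes at x0 if all its moments do: otherwise it lies
    above eps - c sin^2 (x - x0), whose moments are
    (eps - c / (2 N + 2)) J N. *)
Lemma peak_moments (G : R -> R) : 0 < x0 < pi -> cont G ->
  (forall N, rint (fun x => G x * h x ^+ (2 * N)) = 0) -> G x0 <= 0.
Proof.
move=> /andP[x00 x0pi] cG mom; rewrite leNgt; apply/negP => G0.
pose eps := G x0 / 2; have eps0 : 0 < eps by rewrite divr_gt0.
have [lo _ hlo] := EVT_min (ltW (pi_gt0 R)) cG.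
have x0I : x0 \in `[0, pi] by rewrite in_itv /= !ltW.
have [d d0 near_x0] : exists2 d : R, 0 < d &
    forall x : R, 0 <= x <= pi -> `|x - x0| < d -> eps <= G x.
  have [cG0 _ _] := cont_itv cG.
  have := cG0 x0; rewrite in_itv /= x00 x0pi => /(_ isT) /cvgrPdist_lt /(_ eps eps0).
  move=> [d /= d0 hd]; exists d => // x _ xd.
  have := hd x; rewrite /= distrC => /(_ xd).
  by rewrite ltr_norml => /andP[_]; rewrite /eps; lra.
pose del := Num.min d (Num.min x0 (pi - x0)).
have del0 : 0 < del by rewrite !lt_min d0 x00 subr_gt0.
have [del_d del_x del_p] : [/\ del <= d, del <= x0 & del <= pi - x0].
  by rewrite /del !ge_min !lexx ?orbT.
have cos_le t : del <= t <= pi - del -> `|cos t| <= cos del.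
  move=> /andP[dt td]; rewrite ler_norml; apply/andP; split.
    (* cos t >= cos (pi - del) *)
    rewrite -[del]opprK cosN -cosDpi addrC leNgt ltr_cos ?in_itv /=; lra.
  rewrite leNgt ltr_cos ?in_itv /=; lra.
pose q := cos del ^+ 2.
have q1 : q < 1.
  have h1 : cos del < 1 by rewrite -(cos0 R) ltr_cos ?in_itv /=; lra.
  have h2 : -1 < cos del by rewrite -(cospi R) ltr_cos ?in_itv /=; lra.
  have : 0 < (1 - cos del) * (1 + cos del) by rewrite mulr_gt0; lra.
  by rewrite /q expr2; lra.
pose c := (eps + `|G lo|) / (1 - q).
have c0 : 0 <= c by apply: divr_ge0; [rewrite addr_ge0 // ltW|rewrite subr_ge0 ltW].
have h1 x : h x ^+ 2 <= 1.
  have := cos2Dsin2 (1 * x + - x0); rewrite -/(h x).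
  have := sqr_ge0 (sin (1 * x + - x0)); lra.
have lower x : 0 <= x <= pi -> eps - c * (1 - h x ^+ 2) <= G x.
  move=> xI; case: (ltP `|x - x0| del) => xd.
    apply: le_trans (near_x0 x xI (lt_le_trans xd del_d)).
    by rewrite gerBl mulr_ge0 // subr_ge0.
  have far : h x ^+ 2 <= q.
    have hc : `|h x| <= cos del.
      rewrite /h mul1r -cos_norm; apply: cos_le; rewrite xd /=.
      by move: xI => /andP[xI1 xI2]; rewrite ler_norml; apply/andP; split; lra.
    by rewrite /q -[leLHS]real_normK ?num_real // ler_pXn2r ?nnegrE // (le_trans _ hc).
  apply: le_trans (hlo x _); last by rewrite in_itv.
  have : c * (1 - q) <= c * (1 - h x ^+ 2) by rewrite ler_wpM2l // lerD2l lerN2.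
  rewrite {1}/c divfK ?gt_eqF ?subr_gt0 //.
  have := ler_norm (- G lo); rewrite normrN; lra.
have bound N : eps * (2 * N + 2)%:R <= c.
  pose g (x : R) := (eps - c) * h x ^+ (2 * N) + c * h x ^+ (2 * N.+1).
  have cg1 : cont (fun x => (eps - c) * h x ^+ (2 * N)).
    by apply: contM; [exact: cont_cst|exact: contX].
  have cg2 : cont (fun x => c * h x ^+ (2 * N.+1)).
    by apply: contM; [exact: cont_cst|exact: contX].
  have : rint g <= 0.
    rewrite -(mom N); apply: rint_le => [||x xI]; first exact: contD.
      by apply: contM => //; exact: contX.
    have -> : g x = (eps - c * (1 - h x ^+ 2)) * h x ^+ (2 * N).
      by rewrite /g mulnS exprD; ring.
    by apply: ler_wpM2r; [rewrite exprM exprn_ge0 ?sqr_ge0|exact: lower].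
  rewrite /g rintD // !rintZ; try exact: contX.
  rewrite -/(J N) -/(J N.+1) => le0.
  have e := J_rec N; have JN := J_gt0 N.
  have k0 : 0 <= (2 * N + 2)%:R :> R by [].
  have := ler_wpM2l k0 le0; rewrite mulr0 mulrDr [_ * (c * _)]mulrCA e.
  have -> : (2 * N + 2)%:R = (2 * N + 1)%:R + 1 :> R by rewrite addn2 addn1 -natr1.
  move: ((2 * N + 1)%:R) => k le0'.
  rewrite -(ler_pM2r JN); move: le0'; lra.
have [N hN] : exists N : nat, c < eps * N%:R.
  exists (Num.bound (c / eps)); rewrite mulrC -ltr_pdivrMr //.
  by apply: archi_boundP; rewrite divr_ge0 // ltW.
have := bound N; apply/negP; rewrite -ltNge; apply: lt_le_trans hN _.
by rewrite ler_pM2l // ler_nat; int_lia.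
Qed.

End Peak.

(** * Fourier coefficients of an eigenfunction *)

Section ComplexIntegral.
Context {R : realType}.
Local Notation C := R[i].
Local Notation Re := complex.Re.
Local Notation Im := complex.Im.
Implicit Types f g : R -> C.

Definition ccont f := ccontinuous_on `[(0 : R), pi]%classic f.

Definition cint f : C :=
  rint (fun x => Re (f x)) +i* rint (fun x => Im (f x)).

Definition is_cderive (x : R) f (d : C) : Prop :=
  is_derive x 1 (fun t => Re (f t)) (Re d) /\
  is_derive x 1 (fun t => Im (f t)) (Im d).

Lemma ReM (z w : C) : Re (z * w) = Re z * Re w - Im z * Im w.
Proof. by case: z => p q; case: w => r s. Qed.

Lemma ImM (z w : C) : Im (z * w) = Re z * Im w + Im z * Re w.
Proof. by case: z => p q; case: w => r s. Qed.

Lemma ReMreal z (r : R) : Re (z * r%:C) = Re z * r.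
Proof. by rewrite ReM /= mulr0 subr0. Qed.

Lemma ImMreal z (r : R) : Im (z * r%:C) = Im z * r.
Proof. by rewrite ImM /= mulr0 add0r. Qed.

Lemma ReD (z w : C) : Re (z + w) = Re z + Re w.
Proof. by case: z => p q; case: w => r s. Qed.

Lemma ImD (z w : C) : Im (z + w) = Im z + Im w.
Proof. by case: z => p q; case: w => r s. Qed.

Lemma complexP (z w : C) : Re z = Re w -> Im z = Im w -> z = w.
Proof. by case: z => p q; case: w => r s /= -> ->. Qed.

Lemma eq_cont (f g : R -> R) : (forall x, f x = g x) -> cont g -> cont f.
Proof. by move=> /funext ->. Qed.

Lemma eq_derive (f g : R -> R) (x df dg : R) :
  (forall t, f t = g t) -> df = dg -> is_derive x 1 g dg -> is_derive x 1 f df.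
Proof. by move=> /funext -> ->. Qed.

Lemma ccontD f g : ccont f -> ccont g -> ccont (fun x => f x + g x).
Proof.
move=> [f1 f2] [g1 g2]; split.
  by apply: (eq_cont (fun x => ReD _ _)); exact: contD.
by apply: (eq_cont (fun x => ImD _ _)); exact: contD.
Qed.

Lemma ccontM f g : ccont f -> ccont g -> ccont (fun x => f x * g x).
Proof.
move=> [f1 f2] [g1 g2]; split.
  apply: (eq_cont (fun x => ReM _ _)).
  by apply: contD; [exact: contM|apply: contN; exact: contM].
apply: (eq_cont (fun x => ImM _ _)).
by apply: contD; exact: contM.
Qed.

Lemma ccont_cst c : ccont (fun=> c).
Proof. by split; exact: cont_cst. Qed.

Lemma cintD f g : ccont f -> ccont g ->
  cint (fun x => f x + g x) = cint f + cint g.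
Proof.
move=> [f1 f2] [g1 g2]; apply: complexP; rewrite /= -rintD //.
  by congr rint; apply/funext => x; rewrite ReD.
by congr rint; apply/funext => x; rewrite ImD.
Qed.

Lemma cintZ c f : ccont f -> cint (fun x => c * f x) = c * cint f.
Proof.
move=> [f1 f2]; have cZ (p : R) h : cont h -> cont (fun x => p * h x).
  by move=> ch; apply: contM => //; exact: cont_cst.
apply: complexP; rewrite ?ReM ?ImM /= -?mulNr -!rintZ // -rintD; try exact: cZ.
  by congr rint; apply/funext => x; rewrite ReM mulNr.
by congr rint; apply/funext => x; rewrite ImM.
Qed.

Lemma eq_cint f g : (forall x, f x = g x) -> cint f = cint g.
Proof. by move=> fg; congr cint; apply/funext. Qed.

Lemma cint_derive (F f : R -> C) : ccont F -> ccont f ->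
  (forall x : R, 0 < x < pi -> is_cderive x F (f x)) ->
  cint f = F pi - F 0.
Proof.
move=> [F1 F2] [f1 f2] dF; rewrite /cint.
rewrite (rint_derive F1 f1 (fun x hx => (dF x hx).1)).
rewrite (rint_derive F2 f2 (fun x hx => (dF x hx).2)).
by case: (F pi) => p q; case: (F 0) => r s.
Qed.

Lemma is_cderiveM x f g df dg : is_cderive x f df -> is_cderive x g dg ->
  is_cderive x (fun t => f t * g t) (df * g x + f x * dg).
Proof.
move=> [f1 f2] [g1 g2]; split.
  apply: (eq_derive (fun t => ReM _ _) _ (derD (derM f1 g1) (derN (derM f2 g2)))).
  by rewrite ReD !ReM; ring.
apply: (eq_derive (fun t => ImM _ _) _ (derD (derM f1 g2) (derM f2 g1))).
by rewrite ImD !ImM; ring.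
Qed.

Lemma cderivable_is_cderive f x : cderivable f x -> is_cderive x f (cderiv f x).
Proof.
by move=> [/derivableP h1 /derivableP h2]; split; rewrite /cderiv /= derive1E.
Qed.

Lemma expiD (s t : R) : expi (s + t) = expi s * expi t.
Proof.
by rewrite /expi cosD sinD; apply: complexP; rewrite ?ReM ?ImM //= addrC mulrC [in X in _ + X]mulrC.
Qed.

Lemma expi0 : expi (0 : R) = 1.
Proof. by rewrite /expi cos0 sin0. Qed.

Definition cexp (k : int) (x : R) : C := expi (k%:~R * x).

Lemma cexpD k l x : cexp (k + l) x = cexp k x * cexp l x.
Proof. by rewrite /cexp intrD mulrDl expiD. Qed.

Lemma cexp0 x : cexp 0 x = 1.
Proof. by rewrite /cexp mulr0z mul0r expi0. Qed.

Lemma cexp_neq0 k x : cexp k x != 0.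
Proof.
apply/eqP => h; have := cexpD k (- k) x; rewrite subrr cexp0 h mul0r.
by move/eqP; rewrite oner_eq0.
Qed.

Lemma cexp_pi k : cexp k pi = (-1) ^+ `|k|%N.
Proof.
have nat_case (p : nat) : cexp p%:Z pi = (-1) ^+ p.
  elim: p => [|p IH]; first by rewrite cexp0.
  rewrite -addn1 PoszD cexpD IH exprD; congr (_ * _).
  by rewrite /cexp /expi mul1r cospi sinpi; apply: complexP; rewrite /= ?oppr0.
case: k => p; first by rewrite nat_case absz_nat.
rewrite NegzE abszN absz_nat.
have := cexpD p.+1%:Z (- p.+1%:Z) pi; rewrite subrr cexp0 nat_case => e.
have ss : (-1) ^+ p.+1 * (-1) ^+ p.+1 = 1 :> C by rewrite -expr2 sqrr_sign.
by rewrite -[LHS]mul1r -{1}ss -mulrA -e mulr1.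
Qed.

Lemma ccont_cexp k : ccont (cexp k).
Proof.
split; apply: is_derive_cont => x; eexists.
  apply: eq_derive (der_cos_affine k%:~R 0 x) => // t; by rewrite addr0.
by apply: eq_derive (der_sin_affine k%:~R 0 x) => // t; rewrite addr0.
Qed.

Lemma is_cderive_cexp k x : is_cderive x (cexp k) ('i%C * k%:~R * cexp k x).
Proof.
have kE : (k%:~R : C) = (k%:~R : R)%:C by rewrite rmorph_int.
split; rewrite kE.
  apply: eq_derive (der_cos_affine k%:~R 0 x) => [t|]; first by rewrite addr0.
  by rewrite /= !addr0; ring.
apply: eq_derive (der_sin_affine k%:~R 0 x) => [t|]; first by rewrite addr0.
by rewrite /= !addr0; ring.
Qed.

(** * Completeness of the exponentials of fixed parity *)

Definition fcoef (f : R -> C) (k : int) : C := cint (fun x => f x * cexp (- k) x).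

Lemma ccont_fcoef f k : ccont f -> ccont (fun x => f x * cexp (- k) x).
Proof. by move=> cf; apply: ccontM => //; exact: ccont_cexp. Qed.

Let rcos (x0 x : R) : R := cos (1 * x + - x0).

Lemma rcos_sqr x0 x : (rcos x0 x ^+ 2)%:C =
  2^-1 + 4^-1 * (expi (- 2 * x0) * cexp 2 x + expi (2 * x0) * cexp (- 2) x).
Proof.
have e1 : expi (- 2 * x0) * cexp 2 x = expi (2 * (x - x0)).
  by rewrite /cexp -expiD; congr expi; ring.
have e2 : expi (2 * x0) * cexp (- 2) x = expi (- (2 * (x - x0))).
  by rewrite /cexp -expiD; congr expi; rewrite rmorphN /=; ring.
rewrite e1 e2 /rcos mul1r.
set t := x - x0.
have -> : expi (2 * t) + expi (- (2 * t)) = (2 * cos (2 * t))%:C.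
  by rewrite /expi cosN sinN; apply: complexP; rewrite ?ReD ?ImD /=; ring.
have -> : 2 * t = t *+ 2 by rewrite mulr_natl.
rewrite cos_mulr2n.
have -> : 2 * (cos t ^+ 2 *+ 2 - 1) = 4 * cos t ^+ 2 - 2 by ring.
by rewrite rmorphB rmorphM !rmorph_nat; field.
Qed.

Lemma real_ccont (g : R -> R) : cont g -> ccont (fun x => (g x)%:C).
Proof. by move=> cg; split => //; exact: cont_cst. Qed.

Lemma cont_rcos x0 N : cont (fun x => rcos x0 x ^+ N).
Proof.
by apply: contX; apply: is_derive_cont => x; eexists; exact: der_cos_affine.
Qed.

(** Multiplication by cos^2 shifts frequencies by -2, 0 and 2, so it preserves
    their parity. *)
Lemma fcoef0_moments f (n : int) x0 : ccont f ->
  (forall k, (k = n %[mod 2])%Z -> fcoef f k = 0) ->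
  forall N k, (k = n %[mod 2])%Z ->
    cint (fun x => f x * cexp (- k) x * (rcos x0 x ^+ (2 * N))%:C) = 0.
Proof.
move=> cf f0; elim=> [|N IH] k kn.
  rewrite -(f0 k kn); apply: eq_cint => x; by rewrite muln0 expr0 mulr1.
pose T k x := f x * cexp (- k) x * (rcos x0 x ^+ (2 * N))%:C.
have cT l : ccont (T l).
  by apply: ccontM; [exact: ccont_fcoef|apply: real_ccont; exact: cont_rcos].
have cZ c l : ccont (fun x => c * T l x).
  by apply: ccontM => //; exact: ccont_cst.
rewrite (eq_cint (g := fun x => 2^-1 * T k x + (4^-1 * expi (- 2 * x0) * T (k - 2) x +
    4^-1 * expi (2 * x0) * T (k + 2) x))).
  rewrite cintD ?cintD ?cintZ //; last exact: ccontD.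
  have z l : (l = n %[mod 2])%Z -> cint (T l) = 0 by exact: IH.
  by rewrite !z ?mulr0 ?addr0 //; int_lia.
move=> x; rewrite /T mulnS exprD rmorphM /= -[X in X%:C * _]/(rcos x0 x ^+ 2).
rewrite rcos_sqr; have -> : - (k - 2) = - k + 2 by int_lia.
have -> : - (k + 2) = - k + - 2 by int_lia.
by rewrite !cexpD; ring.
Qed.

Lemma cont_vanish (G : R -> R) : cont G -> (forall x, 0 < x < pi -> G x = 0) ->
  forall x, 0 <= x <= pi -> G x = 0.
Proof.
move=> cG G0 x /andP[x0 xp]; have [_ cl cr] := cont_itv cG.
have p0 := pi_gt0 R.
have [->|xn0] := eqVneq x 0.
  suff lim0 : (G t @[t --> 0^'+] --> (0 : R))%classic.
    by rewrite -(cvg_lim (@Rhausdorff R) cl) (cvg_lim (@Rhausdorff R) lim0).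
  apply: cvg_near_cst; near=> t; apply: G0.
  by apply/andP; split; near: t; [exact: nbhs_right_gt|exact: nbhs_right_lt].
have [->|xnp] := eqVneq x pi.
  suff lim0 : (G t @[t --> pi^'-] --> (0 : R))%classic.
    by rewrite -(cvg_lim (@Rhausdorff R) cr) (cvg_lim (@Rhausdorff R) lim0).
  apply: cvg_near_cst; near=> t; apply: G0.
  by apply/andP; split; near: t; [exact: nbhs_left_gt|exact: nbhs_left_lt].
by apply: G0; rewrite !lt_neqAle x0 xp xnp eq_sym xn0.
Unshelve. all: by end_near. Qed.

(** The moments of f e^(-inx) against the real kernels cos^(2N) vanish, hence so
    do its real and imaginary parts. *)
Lemma fcoef_complete f (n : int) : ccont f ->
  (forall k, (k = n %[mod 2])%Z -> fcoef f k = 0) ->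
  forall x, 0 <= x <= pi -> f x = 0.
Proof.
move=> cf f0; pose g x := f x * cexp (- n) x.
have [g1 g2] : ccont g by exact: ccont_fcoef.
have mom x0 N : cint (fun x => g x * (rcos x0 x ^+ (2 * N))%:C) = 0.
  exact: (fcoef0_moments (n := n)).
have vanish (G : R -> R) : cont G ->
    (forall x0 N, rint (fun x => G x * rcos x0 x ^+ (2 * N)) = 0) ->
    forall x, 0 <= x <= pi -> G x = 0.
  move=> cG mG; apply: cont_vanish => // x xI; apply/eqP; rewrite eq_le.
  rewrite (peak_moments xI cG (mG x)) /= -oppr_le0.
  apply: (@peak_moments R x (fun t => - G t)) => //; first exact: contN.
  move=> N; transitivity (-1 * rint (fun t => G t * rcos x t ^+ (2 * N))).
    2: by rewrite mG mulr0.
  rewrite -rintZ.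
    by congr rint; apply/funext => t; ring.
  by apply: contM => //; exact: cont_rcos.
have reg x : 0 <= x <= pi -> Re (g x) = 0.
  apply: (vanish (fun x => Re (g x))) => // x0 N.
  have := congr1 (@complex.Re R) (mom x0 N); rewrite /= => e.
  by rewrite -[RHS]e; congr rint; apply/funext => t; rewrite ReMreal.
have img x : 0 <= x <= pi -> Im (g x) = 0.
  apply: (vanish (fun x => Im (g x))) => // x0 N.
  have := congr1 (@complex.Im R) (mom x0 N); rewrite /= => e.
  by rewrite -[RHS]e; congr rint; apply/funext => t; rewrite ImMreal.
move=> x xI; have : g x = 0 by apply: complexP; rewrite ?reg ?img.
by move/eqP; rewrite mulf_eq0 (negbTE (cexp_neq0 _ _)) orbF => /eqP.
Qed.

Lemma fcoef_bounded f : ccont f -> exists M : R, forall k, cabs (fcoef f k) <= M.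
Proof.
move=> [f1 f2]; pose G x := `|Re (f x)| + `|Im (f x)|.
have cG : cont G by apply: contD; exact: cont_norm.
exists (2 * rint G) => k; have [h1 h2] := ccont_fcoef k (conj f1 f2).
have bnd (H : R -> R) : cont H -> (forall x, `|H x| <= G x) -> `|rint H| <= rint G.
  move=> cH HG; rewrite ler_norml; apply/andP; split.
    rewrite -mulN1r -rintZ //; apply: rint_le => // [|x _].
      by apply: contM => //; exact: cont_cst.
    by have := HG x; rewrite ler_norml mulN1r => /andP[].
  by apply: rint_le => // x _; apply: le_trans (HG x); exact: ler_norm.
have cab (z : C) : cabs z <= `|Re z| + `|Im z|.
  have -> : z = (Re z)%:C + 'i%C * (Im z)%:C.
    by apply: complexP; rewrite ?ReD ?ImD ?ReM ?ImM /=; ring.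
  apply: le_trans (cabsD _ _) _; rewrite cabsM !cabs_real.
  have -> : cabs ('i%C : C) = 1 by rewrite /= expr0n expr1n add0r sqrtr1.
  by rewrite mul1r ReD ImD ReM ImM /=; rewrite !(mul0r, mul1r, subr0, addr0, add0r, mulr0).
have prod_le (p q r s : R) : `|r| <= 1 -> `|s| <= 1 -> `|p * r| + `|q * s| <= `|p| + `|q|.
  by move=> r1 s1; rewrite !normrM lerD // ler_piMr.
apply: le_trans (cab _) _; rewrite mulr_natl mulr2n; apply: lerD; apply: bnd => // x.
  rewrite ReM; apply: le_trans (ler_normB _ _) _.
  by apply: prod_le; rewrite /= ?cos_max ?sin_max.
rewrite ImM; apply: le_trans (ler_normD _ _) _.
by apply: prod_le; rewrite /= ?cos_max ?sin_max.
Qed.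

End ComplexIntegral.

(** * The eigenvalue estimate *)

Section Eigenfunctions.
Context {R : realType}.
Local Notation C := R[i].
Local Notation C2 := (C^o * C^o)%type.
Variables (a A b B : C) (n : int).

(** Integrate the derivative of f e^(-ikx) over [0, pi]: since k has the parity
    of n, the boundary condition leaves no boundary term.  The two lines of
    the Dirac system are the cases s = i and s = - i. *)
Lemma fcoef_ode (f g : R -> C) (s lam c d : C) (k : int) :
  ccont f -> ccont g -> s * s = -1 ->
  f pi = (-1) ^+ `|n|%N * f 0 -> (k = n %[mod 2])%Z ->
  (forall x : R, 0 < x < pi -> cderivable f x /\
     s * cderiv f x + pot c d x * g x = lam * f x) ->
  (lam - s * 'i%C * k%:~R) * fcoef f k =
    c * fcoef g (k + 2) + d * fcoef g (k - 2).
Proof.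
move=> cf cg ss bc kn ode.
pose F x := f x * cexp (- k) x.
pose w x := (lam - s * 'i%C * k%:~R) * (f x * cexp (- k) x) +
  (- c * (g x * cexp (- (k + 2)) x) + - d * (g x * cexp (- (k - 2)) x)).
have cZ (e : C) h l : ccont h -> ccont (fun x => e * (h x * cexp l x)).
  by move=> ch; apply: ccontM; [exact: ccont_cst|apply: ccontM => //; exact: ccont_cexp].
have cw : ccont w by apply: ccontD; [exact: cZ|apply: ccontD; exact: cZ].
have cF : ccont F by apply: ccontM => //; exact: ccont_cexp.
have csw : ccont (fun x => - s * w x) by apply: ccontM => //; exact: ccont_cst.
have := cint_derive cF csw.
have -> : F pi - F 0 = 0.
  rewrite /F bc cexp_pi /cexp mulr0 expi0 mulr1 abszN mulrAC -exprD.
  have -> : (-1) ^+ (`|n|%N + `|k|%N) = 1 :> C.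
    rewrite -signr_odd; have -> : odd (`|n|%N + `|k|%N) = false by clear -kn; lia.
    by rewrite expr0.
  by rewrite mul1r subrr.
rewrite cintZ // => int0.
have s0 : s != 0.
  by apply: contra_eq_neq ss => ->; rewrite mul0r eq_sym oppr_eq0 oner_eq0.
have {int0} : cint w = 0.
  apply/eqP; rewrite -(mulrI_eq0 _ (mulfI (_ : - s != 0))) ?oppr_eq0 //.
  apply/eqP; apply: int0 => x xI; have [fd eqf] := ode x xI.
  have -> : - s * w x = cderiv f x * cexp (- k) x +
      f x * ('i%C * (- k)%:~R * cexp (- k) x).
    have fE : cderiv f x = - s * (lam * f x - pot c d x * g x).
      by rewrite -eqf addrK mulrA mulNr ss opprK mul1r.
    have pE : pot c d x * g x * cexp (- k) x =
        c * (g x * cexp (- (k + 2)) x) + d * (g x * cexp (- (k - 2)) x).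
      have -> : - (k + 2) = - k + - 2 by clear; lia.
      have -> : - (k - 2) = - k + 2 by clear; lia.
      rewrite (cexpD (- k) (- 2)) (cexpD (- k) 2) /pot.
      have -> : expi (- 2 * x) = cexp (- 2) x by rewrite /cexp rmorphN.
      by rewrite -[expi (2 * x)]/(cexp 2 x); ring.
    rewrite fE rmorphN /=.
    have -> : - s * (lam * f x - pot c d x * g x) * cexp (- k) x =
      - s * (lam * f x * cexp (- k) x - pot c d x * g x * cexp (- k) x) by ring.
    rewrite pE /w.
    have -> : f x * ('i%C * - k%:~R * cexp (- k) x) =
      - (s * s) * (f x * ('i%C * - k%:~R * cexp (- k) x)) by rewrite ss; ring.
    ring.
  by apply: is_cderiveM; [exact: cderivable_is_cderive|exact: is_cderive_cexp].
rewrite /w (cintD (cZ _ _ _ cf) (ccontD (cZ _ _ _ cg) (cZ _ _ _ cg))).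
rewrite (cintD (cZ _ _ _ cg) (cZ _ _ _ cg)).
rewrite (cintZ _ (ccont_fcoef _ cf)) !(cintZ _ (ccont_fcoef _ cg)).
move=> e; apply/eqP; rewrite -subr_eq0 -[X in _ == X]e; apply/eqP.
rewrite /fcoef; ring.
Qed.

Definition eigenfunction (lam : C) (y : R -> C2) : Prop :=
  [/\ dirac_dom n y, (exists2 x : R, 0 <= x <= pi & y x <> 0) &
    forall x : R, 0 < x < pi -> dirac_op a A b B y x = lam *: y x].

(** The last nonzero function in the chain y, (L - lam) y, ... *)
Lemma eigenfunction_exists lam k y : in_ker_pow a A b B n lam k y ->
  (exists2 x : R, 0 <= x <= pi & y x <> 0) -> exists y', eigenfunction lam y'.
Proof.
elim: k y => [|k IH] y /=; first by move=> y0 [x xI]; case; exact: y0.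
move=> [dom [w [wE wk]]] nz.
have [w_nz|w0] := pselect (exists2 x : R, 0 <= x <= pi & w x <> 0).
  exact: (IH w).
exists y; split => // x xI; apply/eqP; rewrite -subr_eq0 -wE //; apply/eqP.
apply: contrapT => wx; apply: w0; exists x => //.
by move: xI => /andP[x0 xp]; rewrite !ltW.
Qed.

(** A root space of positive dimension contains a nonzero root function. *)
Lemma eigen_pair_eigenfunction l1 l2 lam : eigen_pair a A b B n l1 l2 ->
  lam = l1 \/ lam = l2 -> cabs (lam - n%:~R) <= 2^-1 /\ exists y, eigenfunction lam y.
Proof.
move=> [h1 h2 _ mult] lamE.
have lam_lt : `|lam - n%:~R| < 2^-1 by case: lamE => ->.
split.
  rewrite -(@lecR R) -normE ltW //; move: lam_lt; congr (_ < _).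
  by rewrite fmorphV rmorph_nat.
have := mult lam lam_lt; have : (0 < (lam == l1) + (lam == l2))%N.
  by case: lamE => ->; rewrite eqxx ?addn1.
move: ((lam == l1) + (lam == l2))%N => d d0 [v [vroot vfree _]].
pose i0 := Ordinal d0; have [k vk] := vroot i0.
apply: (eigenfunction_exists vk); apply: contrapT => v0.
have := vfree (fun i => (i == i0)%:R) _ i0; rewrite eqxx => h.
suff : (1 : C) = 0 by apply/eqP; rewrite oner_eq0.
apply: h => x xI; rewrite (bigD1 i0) // big1 => [|i /= /negbTE ->]; last by rewrite scale0r.
rewrite /= addr0 ?eqxx scale1r; apply: contrapT => vx; apply: v0; by exists x.
Qed.

Lemma eigenfunction_system lam y : eigenfunction lam y ->
  fourier_system a A b B n (lam - n%:~R)
    (fcoef (fun x => (y x).1)) (fcoef (fun x => (y x).2)).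
Proof.
move=> [[c1 c2 dy bc] _ ode] k kn.
have ii : ('i%C : C) * 'i%C = -1 by rewrite -expr2 sqr_i.
have b1 : (y pi).1 = (-1) ^+ `|n|%N * (y 0).1 by rewrite bc.
have b2 : (y pi).2 = (-1) ^+ `|n|%N * (y 0).2 by rewrite bc.
split.
  rewrite -(@fcoef_ode _ _ 'i%C lam a A k c1 c2 ii b1 kn).
    by congr (_ * _); rewrite ii rmorphD /=; ring.
  move=> x xI; have [d1 _] := dy x xI; split => //.
  by have := congr1 fst (ode x xI).
rewrite -(@fcoef_ode _ _ (- 'i%C) lam b B k c2 c1 _ b2 kn).
- congr (_ * _); rewrite mulNr ii rmorphB /=; ring.
- by rewrite mulrNN.
- move=> x xI; have [_ d2] := dy x xI; split => //.
  by have := congr1 snd (ode x xI).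
Qed.

(** The Fourier coefficients of an eigenfunction are bounded and, by
    completeness, not all zero, as fourier_resonance requires. *)
Lemma eigenvalue_estimate (c : R) l1 l2 lam : eigen_pair a A b B n l1 l2 ->
  lam = l1 \/ lam = l2 ->
  cabs a <= c -> cabs A <= c -> cabs b <= c -> cabs B <= c -> 1 <= c ->
  7 <= `|n|%:~R :> R -> 8 * c ^+ 2 <= `|n|%:~R ->
  cabs ((2 * n)%:~R * (lam - n%:~R) - (A * b + a * B)) <= 64 * c ^+ 5 / `|n|%:~R.
Proof.
move=> ep lamE aC AC bC BC c1 N7 Nc.
have [z1 [y ey]] := eigen_pair_eigenfunction ep lamE.
have sys := eigenfunction_system ey.
case: ey => [[cy1 cy2 _ _] [x xI yx] _].
have [M1 hM1] := fcoef_bounded cy1; have [M2 hM2] := fcoef_bounded cy2.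
apply: (fourier_resonance (M := Num.max M1 M2) sys) => //.
  move=> k; split.
    by apply: le_trans (hM1 k) _; rewrite le_max lexx.
  by apply: le_trans (hM2 k) _; rewrite le_max lexx orbT.
apply: contrapT => all0; apply: yx.
have z0 k : (k = n %[mod 2])%Z -> fcoef (fun x => (y x).1) k = 0 /\
    fcoef (fun x => (y x).2) k = 0.
  move=> kn; split; apply/eqP; apply: contrapT => /negP h; apply: all0; exists k; auto.
have e1 : (y x).1 = 0.
  by apply: (fcoef_complete (f := fun x => (y x).1) (n := n)) => // k /z0[].
have e2 : (y x).2 = 0.
  by apply: (fcoef_complete (f := fun x => (y x).2) (n := n)) => // k /z0[].
by move: e1 e2; case: (y x) => p q /= -> ->.
Qed.

End Eigenfunctions.

(** * The two signs of n *)

Section Transfer.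
Context {R : realType}.
Local Notation C := R[i].

(** S / (2n) and S / (4m) differ by O(1 / m^2). *)
Lemma resonance_shift (S zeta : C) (T : R) (m : nat) : (0 < m)%N -> 0 <= T ->
  cabs ((2 * (2 * m + 1)%N%:Z)%:~R * zeta - S) <= T / (2 * m + 1)%N%:R ->
  cabs (zeta - S / (4 * m%:R)) <= (T + cabs S) / m%:R ^+ 2.
Proof.
move=> m0 T0; rewrite intrM -[((2 * m + 1)%N%:Z)%:~R]/((2 * m + 1)%N%:R) => h.
have mR : 0 < m%:R :> R by rewrite ltr0n.
have NR : m%:R <= (2 * m + 1)%N%:R :> R by rewrite ler_nat; int_lia.
have NR0 : 0 < (2 * m + 1)%N%:R :> R := lt_le_trans mR NR.
have mC : m%:R != 0 :> C by rewrite pnatr_eq0 -lt0n.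
have NC : (2 * m + 1)%N%:R != 0 :> C by rewrite pnatr_eq0 addn1.
have NE : (2 * m + 1)%N%:R = 2 * m%:R + 1 :> C by rewrite natrD natrM.
have -> : zeta - S / (4 * m%:R) =
    (2%:~R * (2 * m + 1)%N%:R * zeta - S) / (2 * (2 * m + 1)%N%:R) -
    S / (4 * m%:R * (2 * m + 1)%N%:R).
  have -> : 2%:~R = 2 :> C by [].
  move: NC; rewrite NE => NC; field; rewrite mC /=.
  by rewrite NC.
apply: le_trans (cabsB _ _) _; rewrite [leRHS]mulrDl; apply: lerD.
  rewrite cabsM cabsV cabsM !cabs_nat ler_pdivrMr; last by rewrite mulr_gt0.
  apply: le_trans h _; rewrite ler_pdivrMr //.
  move: ((2 * m + 1)%N%:R) (m%:R) NR NR0 mR => N M MN N0 M0.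
  have -> : T / M ^+ 2 * (2 * N) * N = T * (2 * N * N / M ^+ 2) by ring.
  rewrite ler_peMr // ler_pdivlMr ?exprn_gt0 // mul1r expr2.
  have := ler_pM (ltW M0) (ltW M0) MN MN; have := mulr_gt0 N0 N0; lra.
rewrite cabsM cabsV 2!cabsM !cabs_nat ler_wpM2l ?cabs_ge0 // lef_pV2 ?posrE ?mulr_gt0 ?exprn_gt0 //.
rewrite expr2 -mulrA; apply: le_trans (_ : m%:R * (2 * m + 1)%N%:R <= _).
  by rewrite ler_pM2l.
by have := mulr_gt0 mR NR0; lra.
Qed.

(** For n < 0 the reflection j -> - j turns z into - z and exchanges a with A
    and b with B. *)
Lemma both_signs (a A b B : C) (m : nat) (n : int) (z : C) (P : C -> Prop) :
  n = (2 * m + 1)%N%:Z \/ n = - (2 * m + 1)%N%:Z ->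
  (n = (2 * m + 1)%N%:Z -> exists eps,
    beta_minus a A b B (2 * m + 1)%N%:Z z =
      a ^+ m.+1 * b ^+ m / (4 ^+ (2 * m) * m`!%:R ^+ 2) * (1 + eps) /\ P eps) ->
  (n = - (2 * m + 1)%N%:Z -> exists eps,
    beta_minus A a B b (2 * m + 1)%N%:Z (- z) =
      A ^+ m.+1 * B ^+ m / (4 ^+ (2 * m) * m`!%:R ^+ 2) * (1 + eps) /\ P eps) ->
  exists eps, beta_minus a A b B n z = sigma_minus a A b B 0 n 0 * (1 + eps) /\ P eps.
Proof.
case=> -> pos neg.
  by rewrite sigma_minus0_pos; exact: pos.
by rewrite beta_minusN sigma_minus0_neg; exact: neg.
Qed.

End Transfer.

Theorem proposition16 (R : realType) (a A b B : R[i])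
    (ha : a != 0) (hA : A != 0) (hb : b != 0) (hB : B != 0) :
  [/\ (* z = O(1/m) *)
      (forall K : R, 0 < K ->
        exists (c : R) (M : nat), forall m : nat, (M <= m)%N ->
        forall n : int, n = (2 * m + 1)%N%:Z \/ n = - (2 * m + 1)%N%:Z ->
        forall z : R[i], `|z| <= (K / m%:R)%:C ->
        exists eps : R[i],
          beta_minus a A b B n z = sigma_minus a A b B 0 n 0 * (1 + eps) /\
          `|eps| <= (c * (ln m%:R / m%:R))%:C),
      (* z = z_n^- and z = z_n^+ *)
      (exists (c : R) (M : nat), forall m : nat, (M <= m)%N ->
        forall n : int, n = (2 * m + 1)%N%:Z \/ n = - (2 * m + 1)%N%:Z ->
        forall l1 l2 : R[i], eigen_pair a A b B n l1 l2 ->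
        forall z : R[i], z = l1 - n%:~R \/ z = l2 - n%:~R ->
        exists eps : R[i],
          beta_minus a A b B n z = sigma_minus a A b B 0 n 0 * (1 + eps) /\
          `|eps| <= (c * (ln m%:R ^+ 2 / m%:R ^+ 2))%:C)
    & (forall m : nat,
        sigma_minus a A b B 0 (2 * m + 1)%N%:Z 0 =
          a ^+ m.+1 * b ^+ m / (4 ^+ (2 * m) * (m`!%:R) ^+ 2) /\
        sigma_minus a A b B 0 (- (2 * m + 1)%N%:Z) 0 =
          A ^+ m.+1 * B ^+ m / (4 ^+ (2 * m) * (m`!%:R) ^+ 2))].
Proof.
split.
- move=> K K0.
  have [c1 [M1 h1]] := beta_minus_leading a A b B (ltW K0).
  have [c2 [M2 h2]] := beta_minus_leading A a B b (ltW K0).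
  exists (Num.max c1 c2), (4 + M1 + M2)%N => m mM n nE z.
  rewrite normE lecR => hz.
  have m4 : (4 <= m)%N by clear -mM; lia.
  have r0 : 0 <= ln m%:R / m%:R :> R.
    by rewrite divr_ge0 // (le_trans ler01) // ln_ge1.
  apply: (both_signs (P := fun e => `|e| <= (Num.max c1 c2 * (ln m%:R / m%:R))%:C) nE) => _.
    have [|eps [e1 e2]] := h1 m _ z hz; first by clear -mM; lia.
    exists eps; split=> //; rewrite normE lecR; apply: le_trans e2 _.
    by rewrite ler_wpM2r // le_max lexx.
  have [||eps [e1 e2]] := h2 m _ (- z) _; first by clear -mM; lia.
    by rewrite cabsN.
  exists eps; split=> //; rewrite normE lecR; apply: le_trans e2 _.
  by rewrite ler_wpM2r // le_max lexx orbT.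
- pose c := cabs a + cabs A + cabs b + cabs B + 1.
  have [aC AC bC BC c1] : [/\ cabs a <= c, cabs A <= c, cabs b <= c, cabs B <= c & 1 <= c].
    have := cabs_ge0 a; have := cabs_ge0 A; have := cabs_ge0 b; have := cabs_ge0 B.
    rewrite /c; move: (cabs a) (cabs A) (cabs b) (cabs B) => p q r s *.
    by split; lra.
  pose T := 64 * c ^+ 5.
  have T0 : 0 <= T by rewrite mulr_ge0 // exprn_ge0 // (le_trans ler01).
  pose E := T + cabs (A * b + a * B).
  have E0 : 0 <= E by rewrite addr_ge0 ?cabs_ge0.
  have [k1 [M1 h1]] := beta_minus_second a A b B E0.
  have [k2 [M2 h2]] := beta_minus_second A a B b E0.
  exists (Num.max k1 k2), (4 + M1 + M2 + Num.bound (8 * c ^+ 2))%N => m mM n nE l1 l2 ep z zE.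
  have m4 : (4 <= m)%N by clear -mM; lia.
  have m0 : (0 < m)%N by clear -mM; lia.
  have r0 : 0 <= ln m%:R ^+ 2 / m%:R ^+ 2 :> R by rewrite divr_ge0 ?sqr_ge0.
  have nN : `|n|%:~R = (2 * m + 1)%N%:R :> R.
    by have -> : `|n| = (2 * m + 1)%N%:Z by case: nE => ->; rewrite ?normrN.
  have [lam lamE ->] : exists2 lam, lam = l1 \/ lam = l2 & z = lam - n%:~R.
    by case: zE => ->; [exists l1 => //; left|exists l2 => //; right].
  have N7 : 7 <= `|n|%:~R :> R by rewrite nN (ler_nat R 7); clear -m4; lia.
  have Nc : 8 * c ^+ 2 <= `|n|%:~R.
    rewrite nN; apply: le_trans (ltW (archi_boundP _)) _.
      by rewrite mulr_ge0 // sqr_ge0.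
    by rewrite ler_nat; clear -mM; lia.
  have est := eigenvalue_estimate ep lamE aC AC bC BC c1 N7 Nc.
  rewrite nN in est.
  apply: (both_signs (P := fun e =>
    `|e| <= (Num.max k1 k2 * (ln m%:R ^+ 2 / m%:R ^+ 2))%:C) nE) => nE'.
    rewrite nE' in est *.
    have [|eps [e1 e2]] := h1 m _ _ (resonance_shift m0 T0 est); first by clear -mM; lia.
    exists eps; split=> //; rewrite normE lecR; apply: le_trans e2 _.
    by rewrite ler_wpM2r // le_max lexx.
  have est' : cabs ((2 * (2 * m + 1)%N%:Z)%:~R * - (lam - n%:~R) - (A * b + a * B)) <=
      T / (2 * m + 1)%N%:R.
    by move: est; rewrite {1}nE' mulrN intrN mulNr mulrN.
  have := resonance_shift m0 T0 est'; rewrite -/E [A * b + _]addrC => shift.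
  have [|eps [e1 e2]] := h2 m _ _ shift; first by clear -mM; lia.
  exists eps; split=> //; rewrite normE lecR; apply: le_trans e2 _.
  by rewrite ler_wpM2r // le_max lexx orbT.
- by move=> m; split; [exact: sigma_minus0_pos|exact: sigma_minus0_neg].
Qed.
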